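(* Let $p=5$, $K=\overline{\mathbb{F}_p(t)}$, and let $E$ be the elliptic curve $x_1^2x_2=x_0^3+x_2^3$ in $\mathbb{P}^2_K$ with zero point $O=[0,1,0]$. Let $G=\mathbb{G}_m^3\times(\mathbb{G}_m^2\times E^2)$ (over $K$). Let $$g=\Big((t+\alpha,\,t-\alpha,\,t),\ \big(t+1,\,t,\,(t+1,\sqrt{(t+1)^3+1}),\,(t,\sqrt{t^3+1})\big)\Big)\in G(K),$$ where $\alpha\in\mathbb{F}_{p^2}^{\times}$ is a generator of this cyclic group. Let $V_0\subseteq\mathbb{G}_m^3$ (with coordinates $x,y,z$) be the closed subvariety given by the equation $x+y=2z+2\alpha^2$. Then there exists a closed subvariety $V\subseteq\mathbb{G}_m^2\times E^2$ such that $\{n\in\mathbb{N}\mid n\cdot g\in(V_0\times V)(K)\}$ is not a $p$-normal set in $\mathbb{N}$.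
   Context: Conventions: $\mathbb{N}=\mathbb{Z}_{+}\cup\{0\}$; closed subvarieties may be reducible; the group law of $G$ is written additively, so $n\cdot g$ is the $n$-th multiple of $g$. A point $(a,b)$ of $E(K)$ written with two coordinates denotes the point $[a,b,1]$ of the affine chart, i.e. $b^2=a^3+1$; the square roots in $g$ are arbitrary fixed choices in $K$. The field $\mathbb{F}_{p^2}$ is regarded as a subfield of $K$. $p$-normal sets: an arithmetic progression is a set $\{mk+l\mid k\in\mathbb{Z}\}$ with $m,l\in\mathbb{Z}$ (possibly a singleton). A $p$-normal set in $\mathbb{Z}$ is a union of finitely many arithmetic progressions along with finitely many sets of the form $$\Big\{\frac{c_0}{q-1}+\sum_{i=1}^{d}\frac{c_i}{q-1}q^{n_i}\ \Big|\ n_1,\dots,n_d\in\mathbb{N}\Big\},$$ where $q=p^e$ for some positive integer $e$, $d\in\mathbb{Z}_{+}$, and $c_0,c_1,\dots,c_d$ are integers with $q-1\mid c_0+c_1+\cdots+c_d$. A $p$-normal set in $\mathbb{N}$ is a subset of $\mathbb{N}$ which is, up to a finite set (i.e. with finite symmetric difference), equal to the intersection of a $p$-normal set in $\mathbb{Z}$ with $\mathbb{N}$. *)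

(* Defs.v *)
From HB Require Import structures.
From mathcomp Require Import all_boot all_order all_algebra all_fingroup.
From mathcomp Require Import all_solvable all_field.
From mathcomp Require Import ring.
From mathcomp Require Import mpoly.
From mathcomp Require Import classical_sets cardinality.

Set Implicit Arguments.
Unset Strict Implicit.
Unset Printing Implicit Defensive.

Import GRing.Theory.
Local Open Scope ring_scope.
Local Open Scope classical_set_scope.

(** The multiplicative group, with its group law written additively:
    [x + y] is the product in [K] and [x *+ n] is the [n]-th power. *)
Section MultiplicativeGroup.
Variable K : fieldType.

Record Gm := MkGm { gm_val : K; _ : gm_val != 0 }.

HB.instance Definition _ := [isSub for gm_val].
HB.instance Definition _ := [Choice of Gm by <:].

Lemma gm_neq0 (x : Gm) : gm_val x != 0. Proof. exact: valP x. Qed.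

Definition gm_one := MkGm (oner_neq0 K).
Definition gm_mul (x y : Gm) := MkGm (mulf_neq0 (gm_neq0 x) (gm_neq0 y)).

Lemma gm_inv_subproof (x : Gm) : (gm_val x)^-1 != 0.
Proof. by rewrite invr_eq0 gm_neq0. Qed.
Definition gm_inv (x : Gm) := MkGm (gm_inv_subproof x).

Lemma gm_mulA : associative gm_mul.
Proof. by move=> x y z; apply: val_inj; rewrite /= mulrA. Qed.
Lemma gm_mulC : commutative gm_mul.
Proof. by move=> x y; apply: val_inj; rewrite /= mulrC. Qed.
Lemma gm_mul1 : left_id gm_one gm_mul.
Proof. by move=> x; apply: val_inj; rewrite /= mul1r. Qed.
Lemma gm_mulV : left_inverse gm_one gm_inv gm_mul.
Proof. by move=> x; apply: val_inj; rewrite /= mulVf ?gm_neq0. Qed.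

HB.instance Definition _ :=
  GRing.isZmodule.Build Gm gm_mulA gm_mulC gm_mul1 gm_mulV.

Lemma gm_valMn (x : Gm) n : gm_val (x *+ n) = gm_val x ^+ n.
Proof. by elim: n => [|n IHn]; rewrite ?expr0 // mulrS exprS -IHn. Qed.

End MultiplicativeGroup.

(** The points of the plane projective cubic [x1^2 x2 = x0^3 + x2^3]. A point
    is stored by its normalised representative: [None] is [[0,1,0]] and
    [Some (a, b)] is [[a,b,1]]; [hcoordP] below shows that every point of the
    curve has exactly one such representative. *)
Section EllipticCurve.
Variable K : fieldType.

Definition on_cubic (x : K * K * K) : bool :=
  let: (x0, x1, x2) := x in x1 ^+ 2 * x2 == x0 ^+ 3 + x2 ^+ 3.

Definition normal_rep (P : option (K * K)) : K * K * K :=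
  if P is Some (a, b) then (a, b, 1) else (0, 1, 0).

Record ecurve := MkEcurve { ec_val : option (K * K);
                            _ : on_cubic (normal_rep ec_val) }.

HB.instance Definition _ := [isSub for ec_val].
HB.instance Definition _ := [Choice of ecurve by <:].

Definition hcoord (P : ecurve) : K * K * K := normal_rep (val P).

Lemma on_cubic_aff a b : on_cubic (a, b, 1) = (b ^+ 2 == a ^+ 3 + 1).
Proof. by rewrite /on_cubic mulr1 expr1n. Qed.

Lemma hcoordP (x0 x1 x2 : K) :
    (x0, x1, x2) != (0, 0, 0) -> on_cubic (x0, x1, x2) ->
  exists! P : ecurve, exists2 c : K, c != 0 &
    let: (h0, h1, h2) := hcoord P in (x0, x1, x2) = (c * h0, c * h1, c * h2).
Proof.
move=> nz Hx; case: (eqVneq x2 0) => [x20|x2n0].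
  subst x2; have x00 : x0 = 0.
    move: Hx; rewrite /on_cubic mulr0 expr0n addr0 eq_sym expf_eq0 /=.
    by move/eqP.
  subst x0; have x1n0 : x1 != 0 by apply: contraNneq nz => ->.
  have H : on_cubic (normal_rep None) by rewrite /= mulr0 !expr0n addr0.
  exists (MkEcurve H); split; first by exists x1; rewrite //= mulr0 mulr1.
  case=> [[[a b]|] HP] [c cn0]; last by move=> _; apply: val_inj.
  by case=> _ _ /esym/eqP; rewrite mulr1 (negPf cn0).
have H : on_cubic (normal_rep (Some (x0 / x2, x1 / x2))).
  rewrite /normal_rep on_cubic_aff; move: Hx; rewrite /on_cubic => /eqP Hx.
  have {}Hx : x0 ^+ 3 = x1 ^+ 2 * x2 - x2 ^+ 3 by rewrite Hx addrK.
  by apply/eqP; field: Hx.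
exists (MkEcurve H); split.
  by exists x2; rewrite //= mulr1 ![x2 * _]mulrC !divfK.
case=> [[[a b]|] HP] [c cn0] /=; last by case=> _ _ /eqP; rewrite mulr0 (negPf x2n0).
by case=> e0 e1 e2; apply: val_inj; rewrite /= e0 e1 e2 mulr1 ![c * _]mulrC !mulfK.
Qed.

(** The chord-tangent law with neutral element [[0,1,0]]. Three points of the
    curve have sum zero when they are the intersection of the curve with a
    line; [l] is the slope of the line through the two arguments. *)
Definition ec_add_rep (P Q : option (K * K)) : option (K * K) :=
  match P, Q with
  | None, _ => Q
  | _, None => P
  | Some (x1, y1), Some (x2, y2) =>
    if (x1 == x2) && (y1 == - y2) then None else
    let l := if x1 == x2 then (3 * x1 ^+ 2) / (2 * y1)
             else (y2 - y1) / (x2 - x1) in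
    let x3 := l ^+ 2 - x1 - x2 in
    Some (x3, l * (x1 - x3) - y1)
  end.

Lemma ec_zero_subproof : on_cubic (normal_rep None).
Proof. by rewrite /= mulr0 !expr0n addr0. Qed.

Lemma ec_add_subproof (P Q : ecurve) :
  on_cubic (normal_rep (ec_add_rep (val P) (val Q))).
Proof.
case: P Q => [[[x1 y1]|] HP] [[[x2 y2]|] HQ] //=; last first.
move: HP HQ; rewrite /normal_rep !on_cubic_aff => /eqP HP /eqP HQ.
case: (eqVneq x1 x2) => [x12|x12] /=.
  subst x2; case: (eqVneq y1 (- y2)) => [//|y12] /=.
    by rewrite mulr0 !expr0n addr0.
  have y12' : y1 = y2.
    have /eqP : y1 ^+ 2 = y2 ^+ 2 by rewrite HP HQ.
    by rewrite eqf_sqr (negPf y12) orbF => /eqP.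
  subst y2; have d0 : 2 * y1 != 0.
    by rewrite mulr_natl mulr2n -subr_eq0 opprK in y12 *.
  apply/eqP; field: HP.
  by rewrite mulf_eq0 negb_or andbC in d0.
have d0 : x2 - x1 != 0 by rewrite subr_eq0 eq_sym.
apply/eqP.
by field: HP HQ.
Qed.

Definition ec_zero : ecurve := @MkEcurve None ec_zero_subproof.
Definition ec_add (P Q : ecurve) : ecurve := MkEcurve (ec_add_subproof P Q).

(** Only addition and zero are registered: they determine [P *+ n], and in
    characteristic 2 or 3, where the cubic is singular, [ec_add] is not a group
    law. *)
HB.instance Definition _ := Algebra.hasAdd.Build ecurve ec_add.
HB.instance Definition _ := Algebra.hasZero.Build ecurve ec_zero.

End EllipticCurve.

Section SemiabelianVariety.
Variable K : fieldType.

Definition Gm3 : Type := (Gm K * Gm K * Gm K)%type.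
Definition Gm2E2 : Type := (Gm K * Gm K * ecurve K * ecurve K)%type.

(** Polynomials in [(u, v; x0, x1, x2; y0, y1, y2)], the coordinates of
    the two factors [Gm] and homogeneous coordinates on the two planes. *)
Definition bihomog (p : {mpoly K[8]}) : Prop :=
  exists d e : nat, forall m : 'X_{1..8}, m \in msupp p ->
    (\sum_(i < 8 | 2 <= i < 5) m i = d)%N /\ (\sum_(i < 8 | 5 <= i) m i = e)%N.

Definition coords (w : Gm2E2) : 8.-tuple K :=
  let: (u, v, P, Q) := w in
  let: (x0, x1, x2) := hcoord P in
  let: (y0, y1, y2) := hcoord Q in
  [tuple gm_val u; gm_val v; x0; x1; x2; y0; y1; y2].

(** As [Gm^2 x E^2] is a locally closed subset of [A^2 x P^2 x P^2], its closed
    subsets are the zero loci of finitely many polynomials homogeneous in each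
    of the two triples of variables. *)
Definition closed_subvariety (V : set Gm2E2) : Prop :=
  exists2 ps : seq {mpoly K[8]}, (forall p, p \in ps -> bihomog p) &
    V = [set w | forall p, p \in ps -> p.@[tnth (coords w)] = 0].

Definition V0 (alpha : K) : set Gm3 :=
  [set w : Gm3 | gm_val w.1.1 + gm_val w.1.2
                 = 2 * gm_val w.2 + 2 * alpha ^+ 2].

End SemiabelianVariety.

Section PNormalSets.
Variable p : nat.

Definition arith_prog (A : set int) : Prop :=
  exists m l : int, A = [set m * k + l | k in [set: int]].

Definition exp_sum_set (A : set int) : Prop :=
  exists (e d : nat) (c0 : int) (c : 'I_d -> int),
    let q : int := (p ^ e)%:Z in
    [/\ (0 < e)%N, (0 < d)%N, (q - 1 %| c0 + \sum_(i < d) c i)%Z &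
        A = [set z : int | exists n : 'I_d -> nat,
               z%:Q = c0%:Q / (q - 1)%:Q
                      + \sum_(i < d) (c i)%:Q / (q - 1)%:Q * q%:Q ^+ n i]].

Definition p_normal_int (A : set int) : Prop :=
  exists (r : nat) (B : 'I_r -> set int),
    (forall i, arith_prog (B i) \/ exp_sum_set (B i)) /\
    A = [set z | exists i, B i z].

Definition p_normal_nat (A : set nat) : Prop :=
  exists2 B : set int, p_normal_int B &
    finite_set (A `+` [set n : nat | B n%:Z]).

End PNormalSets.

(* Main.v *)
(* The equation of V0 holds for exactly the n = 25^i + 25^j: all binomial
   coefficients C(n, k) with k even, 0 < k < n, must vanish modulo 5, which
   leaves n = 5^i + 5^j, and alpha^n = alpha^2 makes both exponents even.
   For such n the Gm^2 part of n * g determines {t^(25^i), t^(25^j)} as the roots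
   of T^2 - (u - v - 1) T + v. On the supersingular curve E multiplication by -5
   is the 25-power Frobenius, so the E^2 part is a sum of two points with
   [x]-coordinates t^(25^(2i)) and t^(25^(2j)), respectively t^(25^(2i)) + 1 and
   t^(25^(2j)) + 1. Hence if i = 2j the roots X above include the coordinate of
   one of these summands, and the condition "subtracting from the two E-parts
   points over X and X + 1 leaves points over some Z and Z + 1" cuts out a
   hypersurface V containing n * g for all n = 25^(2j) + 25^j.
   For fixed j and large i the point n * g is not in V: one would get
   x(M'P) = x(MQ) + 1 with M, M' = 1 or -1 modulo 5 and M large. As 5 acts
   through Frobenius, invariance of dx / y gives D(f)^2 (t^3 + 1) = f^3 + 1 for
   f = x(MQ) and D = d/dt; comparing with the same identity for f + 1 over t + 1,
   f is a root of a nonzero cubic independent of M, while the x(MQ), M > 0, are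
   pairwise distinct.
   A 5-normal set containing all 25^(2j) + 25^j must, for some j, contain
   infinitely many 25^i + 25^j, a contradiction. *)

Require Import Defs.
From HB Require Import structures.
From mathcomp Require Import all_boot all_order all_algebra all_fingroup.
From mathcomp Require Import all_solvable all_field.
From mathcomp Require Import ring zify.
From mathcomp Require Import mpoly.
From mathcomp Require Import boolp classical_sets cardinality.

Set Implicit Arguments.
Unset Strict Implicit.
Unset Printing Implicit Defensive.

Import GRing.Theory Num.Theory Order.TTheory.
Local Open Scope ring_scope.

(** * The group law *)

Section GroupLaw.
Variable K : fieldType.
Hypotheses (two_neq0 : 2%:R != 0 :> K) (three_neq0 : 3%:R != 0 :> K).
Implicit Types A B C D : ecurve K.

Lemma ec_neg_subproof A :
  on_cubic (normal_rep (if val A is Some (x, y) then Some (x, - y) else None)).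
Proof.
by case: A => [[[x y]|] HA] //; move: HA; rewrite /= sqrrN.
Qed.

Definition ec_neg A : ecurve K := MkEcurve (ec_neg_subproof A).

Lemma affP (x y : K) : y ^+ 2 = x ^+ 3 + 1 -> on_cubic (normal_rep (Some (x, y))).
Proof. by rewrite /normal_rep on_cubic_aff => ->. Qed.

Definition aff x y (h : y ^+ 2 = x ^+ 3 + 1) : ecurve K := MkEcurve (affP h).

Variant ec_spec : ecurve K -> Type :=
| EcZero : ec_spec (ec_zero K)
| EcAff x y (h : y ^+ 2 = x ^+ 3 + 1) : ec_spec (aff h).

Lemma ecP A : ec_spec A.
Proof.
case: A => [[[x y]|] HA]; last first.
  have -> : MkEcurve HA = ec_zero K by apply: val_inj.
  exact: EcZero.
have h : y ^+ 2 = x ^+ 3 + 1 by move: HA; rewrite /normal_rep on_cubic_aff => /eqP.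
have -> : MkEcurve HA = aff h by apply: val_inj.
exact: EcAff.
Qed.

Lemma aff_inj x y x' y' (h : y ^+ 2 = x ^+ 3 + 1) (h' : y' ^+ 2 = x' ^+ 3 + 1) :
  x = x' -> y = y' -> aff h = aff h'.
Proof. by move=> ex ey; apply: val_inj; rewrite /= ex ey. Qed.

Lemma ec_add0 : left_id (ec_zero K) (@ec_add K).
Proof. by move=> A; apply: val_inj => /=; case: (val A). Qed.

Lemma ec_addr0 : right_id (ec_zero K) (@ec_add K).
Proof. by move=> A; apply: val_inj => /=; case: (val A) => [[]|]. Qed.

Lemma ec_addC : commutative (@ec_add K).
Proof.
move=> A B; case: (ecP A) => [|x1 y1 h1]; first by rewrite ec_add0 ec_addr0.
case: (ecP B) => [|x2 y2 h2]; first by rewrite ec_add0 ec_addr0.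
apply: val_inj; rewrite /= [x2 == x1]eq_sym.
have [x12|x12] /= := eqVneq x1 x2.
  rewrite -x12 in h2 *; rewrite [y2 == _]eq_sym eqr_oppLR.
  case: (eqVneq y1 (- y2)) => // y12.
  have /eqP : y1 ^+ 2 = y2 ^+ 2 by rewrite h1 h2.
  by rewrite eqf_sqr (negPf y12) orbF => /eqP <-.
have d : x2 - x1 != 0 by rewrite subr_eq0 eq_sym.
by congr (Some (_, _)); field; rewrite d -opprB oppr_eq0 d.
Qed.

Lemma ec_add_neg A : ec_add A (ec_neg A) = ec_zero K.
Proof.
case: (ecP A) => [|x y h]; apply: val_inj; first by [].
by rewrite /= opprK !eqxx.
Qed.

Lemma ec_negK : involutive ec_neg.
Proof. by move=> A; case: (ecP A) => [|x y h]; apply: val_inj; rewrite //= opprK. Qed.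

Lemma ec_neg_add A B : ec_neg (ec_add A B) = ec_add (ec_neg A) (ec_neg B).
Proof.
case: (ecP A) => [|x1 y1 h1].
  by rewrite ec_add0; apply: val_inj => /=; case: (val B) => [[]|].
case: (ecP B) => [|x2 y2 h2]; first by rewrite ec_addr0; apply: val_inj.
apply: val_inj; rewrite /= opprK [- y1 == _]eqr_oppLR.
have [x12|x12] /= := eqVneq x1 x2.
  rewrite -x12 in h2 *.
  case: (eqVneq y1 (- y2)) => // y12.
  have d0 : y1 != 0.
    apply: contraNneq y12 => y0; have /eqP : y2 ^+ 2 = 0 by rewrite h2 -h1 y0 expr0n.
    by rewrite y0 expf_eq0 /= => /eqP ->; rewrite oppr0.
  by congr (Some (_, _)); field; rewrite ?oppr_eq0 d0 two_neq0.
have d : x2 - x1 != 0 by rewrite subr_eq0 eq_sym.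
by congr (Some (_, _)); field; rewrite d.
Qed.

Section Affine.
Variables (x1 y1 x2 y2 : K) (h1 : y1 ^+ 2 = x1 ^+ 3 + 1) (h2 : y2 ^+ 2 = x2 ^+ 3 + 1).

Lemma aff_eqx : x1 = x2 -> aff h1 = aff h2 \/ aff h1 = ec_neg (aff h2).
Proof.
move=> x12; have /eqP : y1 ^+ 2 = y2 ^+ 2 by rewrite h1 h2 x12.
rewrite eqf_sqr => /orP[] /eqP y12; [left | right]; first exact: aff_inj.
by apply: val_inj; rewrite /= y12 x12.
Qed.

Definition slope := (y2 - y1) / (x2 - x1).
Definition sec_x := slope ^+ 2 - x1 - x2.
Definition sec_y := slope * (x1 - sec_x) - y1.

Definition tslope := (3 * x1 ^+ 2) / (2 * y1).
Definition tan_x := tslope ^+ 2 - x1 - x1.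
Definition tan_y := tslope * (x1 - tan_x) - y1.

Lemma secP : x2 - x1 != 0 -> sec_y ^+ 2 = sec_x ^+ 3 + 1.
Proof. by move=> d; rewrite /sec_y /sec_x /slope; field: h1 h2. Qed.

Lemma tanP : y1 != 0 -> tan_y ^+ 2 = tan_x ^+ 3 + 1.
Proof. by move=> d; rewrite /tan_y /tan_x /tslope; field: h1; rewrite d two_neq0. Qed.

Lemma add_sec (d : x2 - x1 != 0) : ec_add (aff h1) (aff h2) = aff (secP d).
Proof.
apply: val_inj; have /negPf e : x1 != x2 by rewrite eq_sym -subr_eq0.
by rewrite /= e.
Qed.

Lemma add_tan (d : y1 != 0) : ec_add (aff h1) (aff h1) = aff (tanP d).
Proof.
have /negPf e : y1 != - y1.
  by rewrite -subr_eq0 opprK -mulr2n -mulr_natl mulf_neq0.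
by apply: val_inj; rewrite /= eqxx e.
Qed.

End Affine.

Lemma aff_y0 x y (h : y ^+ 2 = x ^+ 3 + 1) : y = 0 -> aff h = ec_neg (aff h).
Proof. by move=> y0; apply: val_inj; rewrite /= y0 oppr0. Qed.

Lemma four_neq0 : 4 != 0 :> K.
Proof. by rewrite (_ : 4 = 2 * 2) ?mulf_neq0 //; ring. Qed.

(** Cancellation is proved before associativity, whose degenerate cases all reduce to it. Here too
    the generic case is an identity modulo the curve equations, and only tangencies at [B] need
    separate treatment. *)
Lemma ec_addK A B : ec_add (ec_add A B) (ec_neg B) = A.
Proof.
case: (ecP A) => [|x1 y1 h1]; first by rewrite ec_add0 ec_add_neg.
case: (ecP B) => [|x2 y2 h2].
  by rewrite ec_addr0 (_ : ec_neg _ = ec_zero K) ?ec_addr0 //; exact: val_inj.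
have h2' : (- y2) ^+ 2 = x2 ^+ 3 + 1 by rewrite sqrrN.
have negB : ec_neg (aff h2) = aff h2' by exact: val_inj.
case: (eqVneq (aff h1) (ec_neg (aff h2))) => [->|nAB].
  by rewrite [ec_add (ec_neg _) _]ec_addC ec_add_neg ec_add0.
case: (eqVneq x1 x2) => [x12|x12].
  case: (aff_eqx h1 h2 x12) => AB; last by rewrite AB eqxx in nAB.
  have d : y2 != 0 by apply: contraNneq nAB => y0; rewrite AB -aff_y0.
  rewrite AB (add_tan h2 d) negB.
  (* If [B + B] lies over the same abscissa as [B], then [B] is a flex and [B + B = - B]. *)
  case: (eqVneq (x2 - tan_x x2 y2) 0) => [e|e].
    have d' : - y2 != 0 by rewrite oppr_eq0.
    rewrite (_ : aff (tanP h2 d) = aff h2'); last first.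
      apply: aff_inj; first by apply/eqP; rewrite eq_sym -subr_eq0 e.
      by rewrite /tan_y e mulr0 sub0r.
    have e' : tan_x x2 (- y2) = x2.
      by rewrite /tan_x /tslope mulrN invrN mulrN sqrrN; apply/eqP; rewrite eq_sym -subr_eq0 e.
    by rewrite (add_tan h2' d'); apply: aff_inj; rewrite // /tan_y e' subrr mulr0 sub0r opprK.
  (* [field] asks for the nonvanishing of an expanded polynomial, recognised as this difference
     times its cleared denominator. *)
  have side c : (c = (x2 - tan_x x2 y2) * (4 * y2 ^+ 2)) -> c != 0.
    by move=> ->; rewrite !mulf_neq0 ?expf_neq0 ?four_neq0.
  rewrite (add_sec _ _ e); apply: aff_inj.
    rewrite /sec_x /slope /tan_y /tan_x /tslope; field: h2.
    rewrite d two_neq0 /=; apply: side; rewrite /tan_x /tslope; field; by rewrite d two_neq0.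
  rewrite /sec_y /sec_x /slope /tan_y /tan_x /tslope; field: h2.
  rewrite d two_neq0 /=; apply: side; rewrite /tan_x /tslope; field; by rewrite d two_neq0.
have d : x2 - x1 != 0 by rewrite subr_eq0 eq_sym.
rewrite (add_sec _ _ d) negB.
case: (eqVneq (x2 - sec_x x1 y1 x2 y2) 0) => [e|e].
  (* When [A + B = - B], the chord meets the curve twice at [B], so its slope is that of the tangent
     there. *)
  have tang : 2 * slope x1 y1 x2 y2 * y2 = 3 * x2 ^+ 2.
    move: e; rewrite /sec_x => /eqP; rewrite subr_eq0 eq_sym subr_eq => /eqP e.
    have {}e : slope x1 y1 x2 y2 ^+ 2 = x1 + 2 * x2.
      move/eqP: e; rewrite subr_eq => /eqP ->; ring.
    have : slope x1 y1 x2 y2 * (y1 + y2) = x1 ^+ 2 + x1 * x2 + x2 ^+ 2.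
      by rewrite /slope; field: h1 h2.
    have -> : 2 * slope x1 y1 x2 y2 * y2 =
        slope x1 y1 x2 y2 * (y1 + y2) + slope x1 y1 x2 y2 ^+ 2 * (x2 - x1).
      by rewrite /slope; field.
    by rewrite e => ->; ring.
  have d' : - y2 != 0.
    rewrite oppr_eq0; apply: contraTneq isT => y0; have := h2; move: tang.
    rewrite y0 mulr0 => /esym/eqP; rewrite mulf_eq0 (negPf three_neq0) expf_eq0 /= => /eqP ->.
    by move/eqP; rewrite !expr0n /= add0r eq_sym oner_eq0.
  have y20 : y2 != 0 by rewrite -oppr_eq0.
  rewrite (_ : aff (secP h1 h2 d) = aff h2'); last first.
    apply: aff_inj; first by apply/eqP; rewrite eq_sym -subr_eq0 e.
    have -> : sec_y x1 y1 x2 y2 = slope x1 y1 x2 y2 * (x2 - sec_x x1 y1 x2 y2) - y2.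
      by rewrite /sec_y /slope; field.
    by rewrite e mulr0 sub0r.
  have ts : tslope x2 (- y2) = - slope x1 y1 x2 y2.
    by rewrite /tslope -tang; field; rewrite ?oppr_eq0 ?y20 ?two_neq0 ?d.
  have tx : tan_x x2 (- y2) = x1.
    rewrite /tan_x ts sqrrN; move: e; rewrite /sec_x => /eqP.
    by rewrite subr_eq0 => /eqP {2}->; ring.
  rewrite (add_tan h2' d'); apply: aff_inj; first exact: tx.
  by rewrite /tan_y ts tx /slope; field.
have side c : (c = (x2 - sec_x x1 y1 x2 y2) * (x2 - x1) ^+ 2) -> c != 0.
  by move=> ->; rewrite !mulf_neq0 ?expf_neq0.
rewrite (add_sec _ _ e); apply: aff_inj.
  rewrite /sec_x /slope /sec_y /sec_x /slope; field: h1 h2.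
  rewrite d /=; apply: side; rewrite /sec_x /slope; field; by rewrite d.
rewrite {1}/sec_y {1 2}/sec_x {1 2 3}/slope /sec_y /sec_x /slope; field: h1 h2.
rewrite d /=; apply: side; rewrite /sec_x /slope; field; by rewrite d.
Qed.

(** The hypotheses make all four additions chord additions, which leaves an identity of rational
    functions modulo the three curve equations. *)
Lemma ec_assoc_sec A B C :
    let z := ec_zero K in
    A != z -> B != z -> C != z -> A != B -> A != ec_neg B -> B != C -> B != ec_neg C ->
    ec_add A B != C -> ec_add A B != ec_neg C ->
    ec_add B C != A -> ec_add B C != ec_neg A ->
  ec_add (ec_add A B) C = ec_add A (ec_add B C).
Proof.
move=> z; case: (ecP A) => [|x1 y1 h1 _]; first by rewrite eqxx.
case: (ecP B) => [|x2 y2 h2 _]; first by rewrite eqxx.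
case: (ecP C) => [|x3 y3 h3 _]; first by rewrite eqxx.
have dif u v u' v' (h : v ^+ 2 = u ^+ 3 + 1) (h' : v' ^+ 2 = u' ^+ 3 + 1) :
    aff h != aff h' -> aff h != ec_neg (aff h') -> u' - u != 0.
  move=> n1 n2; rewrite subr_eq0 eq_sym; apply: contraNneq n1 => uu.
  by case: (aff_eqx h h' uu) => [->|e]; [exact: eqxx | rewrite e eqxx in n2].
move=> n1 n2; have d12 := dif _ _ _ _ _ _ n1 n2.
move=> n3 n4; have d23 := dif _ _ _ _ _ _ n3 n4.
rewrite (add_sec _ _ d12) (add_sec _ _ d23).
move=> n5 n6; have d123 := dif _ _ _ _ _ _ n5 n6.
move=> n7 n8; have := dif _ _ _ _ _ _ n7 n8; rewrite -oppr_eq0 opprB => d231.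
rewrite (add_sec _ _ d123) (add_sec _ _ d231).
have side c : c = (x3 - sec_x x1 y1 x2 y2) * (x2 - x1) ^+ 2 -> c != 0.
  by move=> ->; rewrite !mulf_neq0 ?expf_neq0.
have side' c : c = (sec_x x2 y2 x3 y3 - x1) * (x3 - x2) ^+ 2 -> c != 0.
  by move=> ->; rewrite !mulf_neq0 ?expf_neq0.
clear dif z n1 n2 n3 n4 n5 n6 n7 n8.
apply: aff_inj; rewrite /sec_y /sec_x /slope /sec_y /sec_x /slope;
  (field: h1 h2 h3); rewrite d12 d23 /=.
  apply/andP; split; [apply: side'|apply: side]; rewrite /sec_x /slope; by field.
apply/andP; split; [apply: side'|apply: side]; rewrite /sec_x /slope; by field.
Qed.

(** Same computation with [A + A] given by the tangent and the three other additions by chords. *)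
Lemma ec_assoc_tan A C :
    let z := ec_zero K in
    A != z -> C != z -> A != ec_neg A -> A != C -> A != ec_neg C ->
    ec_add A A != C -> ec_add A A != ec_neg C ->
    ec_add A C != A -> ec_add A C != ec_neg A ->
  ec_add (ec_add A A) C = ec_add A (ec_add A C).
Proof.
move=> z; case: (ecP A) => [|x1 y1 h1 _]; first by rewrite eqxx.
case: (ecP C) => [|x3 y3 h3 _]; first by rewrite eqxx.
have dif u v u' v' (h : v ^+ 2 = u ^+ 3 + 1) (h' : v' ^+ 2 = u' ^+ 3 + 1) :
    aff h != aff h' -> aff h != ec_neg (aff h') -> u' - u != 0.
  move=> n1 n2; rewrite subr_eq0 eq_sym; apply: contraNneq n1 => uu.
  by case: (aff_eqx h h' uu) => [->|e]; [exact: eqxx | rewrite e eqxx in n2].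
move=> n0; have d : y1 != 0 by apply: contraNneq n0 => y0; rewrite -aff_y0.
move=> n1 n2; have d13 := dif _ _ _ _ _ _ n1 n2.
rewrite (add_tan _ d) (add_sec _ _ d13).
move=> n5 n6; have d113 := dif _ _ _ _ _ _ n5 n6.
move=> n7 n8; have := dif _ _ _ _ _ _ n7 n8; rewrite -oppr_eq0 opprB => d131.
rewrite (add_sec _ _ d113) (add_sec _ _ d131).
have side c : c = (x3 - tan_x x1 y1) * (4 * y1 ^+ 2) -> c != 0.
  by move=> ->; rewrite !mulf_neq0 ?expf_neq0 ?four_neq0.
have side' c : c = (sec_x x1 y1 x3 y3 - x1) * (x3 - x1) ^+ 2 -> c != 0.
  by move=> ->; rewrite !mulf_neq0 ?expf_neq0.
clear dif z n0 n1 n2 n5 n6 n7 n8.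
apply: aff_inj; rewrite /sec_y /sec_x /slope /sec_y /sec_x /slope /tan_y /tan_x /tslope;
  (field: h1 h3); rewrite d13 d two_neq0 /=.
  apply/andP; split; [apply: side'|apply: side]; rewrite /sec_x /slope /tan_x /tslope;
    field; by rewrite ?d ?d13 ?two_neq0.
apply/andP; split; [apply: side'|apply: side]; rewrite /sec_x /slope /tan_x /tslope;
  field; by rewrite ?d ?d13 ?two_neq0.
Qed.

Lemma ec_addKC A B : ec_add (ec_neg A) (ec_add A B) = B.
Proof. by rewrite ec_addC [ec_add A B]ec_addC ec_addK. Qed.

Lemma ec_addNKC A B : ec_add A (ec_add (ec_neg A) B) = B.
Proof. by rewrite -{1}[A]ec_negK ec_addKC. Qed.

Lemma ec_add_eql A B C : (ec_add A B == C) = (A == ec_add C (ec_neg B)).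
Proof.
apply/eqP/eqP => [<-|->]; first by rewrite ec_addK.
by rewrite -{2}[B]ec_negK ec_addK.
Qed.

Lemma ec_add_eqr A B C : (ec_add A B == C) = (B == ec_add (ec_neg A) C).
Proof. by rewrite ec_addC ec_add_eql ec_addC. Qed.

Lemma ec_neg0 : ec_neg (ec_zero K) = ec_zero K.
Proof. exact: val_inj. Qed.

(* When [A + A = C], the tangent formula is applied at [C] and [- A] instead:
   [(C + C) - A = C + (C - A) = C + A]. *)
Lemma ec_assoc_dbl A C : ec_add (ec_add A A) C = ec_add A (ec_add A C).
Proof.
case: (eqVneq A (ec_zero K)) => [->|A0]; first by rewrite !ec_add0.
case: (eqVneq C (ec_zero K)) => [->|C0]; first by rewrite !ec_addr0.
case: (eqVneq A (ec_neg C)) => [AC|nAC].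
  by rewrite -[C]ec_negK -AC ec_addK ec_add_neg ec_addr0.
case: (eqVneq A (ec_neg A)) => [AA|nAA].
  by rewrite {2}AA ec_add_neg ec_add0 {1}AA ec_addKC.
case: (eqVneq A C) => [->|AC]; first exact: ec_addC.
case: (eqVneq (ec_add A A) (ec_neg C)) => [AAC|nAAC].
  rewrite AAC [LHS]ec_addC ec_add_neg -[C]ec_negK -AAC ec_neg_add.
  by rewrite ec_addNKC ec_add_neg.
have nACA : ec_add A C != ec_neg A.
  by apply: contraNneq nAAC => /eqP; rewrite ec_add_eqr => /eqP ->; rewrite ec_neg_add !ec_negK.
case: (eqVneq (ec_add A A) C) => [AAC|AAC]; last first.
  apply: ec_assoc_tan => //; rewrite ec_add_eqr.
  by rewrite [ec_add _ A]ec_addC ec_add_neg.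
rewrite AAC; case: (eqVneq (ec_add C C) (ec_neg A)) => [CCA|CCA].
  have -> : ec_add A C = ec_neg C.
    apply/eqP; move/eqP: CCA; rewrite ec_add_eql => /eqP e.
    by rewrite {1}e ec_addNKC.
  by rewrite CCA -AAC ec_neg_add ec_addNKC.
have CA : ec_add C (ec_neg A) = A by rewrite -AAC ec_addK.
have CA' : C != ec_neg A by apply: contraNneq nAC => ->; rewrite ec_negK.
have e : ec_add (ec_add C C) (ec_neg A) = ec_add C A.
  rewrite ec_assoc_tan ?CA ?ec_negK // 1?eq_sym //.
  - by apply: contra_neq A0 => A0; rewrite -[A]ec_negK -A0 ec_neg0.
  - by rewrite eq_sym -{1}AAC.
  rewrite eq_sym ec_add_eql; apply: contraNneq CA' => e.
  by rewrite {1}e -AAC ec_neg_add ec_addNKC.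
have := ec_addK (ec_add C C) (ec_neg A); rewrite e ec_negK => <-.
by rewrite ec_addC [ec_add C A]ec_addC.
Qed.

(** The exceptional case of associativity in which one side is a doubling: [ec_assoc_dbl] gives
    [C + C - (B + C) = C - B = A], and [B + C] is added back. *)
Lemma ec_assoc_aux A B C :
  ec_add A B = C -> ec_add C C = ec_add A (ec_add B C).
Proof.
move=> e; have := ec_addK (ec_add C C) (ec_neg (ec_add B C)).
by rewrite ec_negK ec_neg_add [ec_add (ec_neg B) _]ec_addC ec_assoc_dbl ec_addNKC -{1}e ec_addK.
Qed.

Lemma ec_addA : associative (@ec_add K).
Proof.
move=> A B C; apply/esym.
case: (eqVneq A (ec_zero K)) => [->|A0]; first by rewrite !ec_add0.
case: (eqVneq B (ec_zero K)) => [->|B0]; first by rewrite ec_addr0 ec_add0.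
case: (eqVneq C (ec_zero K)) => [->|C0]; first by rewrite !ec_addr0.
case: (eqVneq A (ec_neg B)) => [->|nAB].
  by rewrite [ec_add (ec_neg B) B]ec_addC ec_add_neg ec_add0 ec_addKC.
case: (eqVneq B (ec_neg C)) => [BC|nBC].
  by rewrite -[C]ec_negK -BC ec_addK ec_add_neg ec_addr0.
case: (eqVneq A B) => [->|AB]; first exact: ec_assoc_dbl.
case: (eqVneq B C) => [->|BC].
  by rewrite ec_addC [ec_add A C]ec_addC -ec_assoc_dbl ec_addC.
case: (eqVneq (ec_add A B) (ec_neg C)) => [ABC|nABC].
  rewrite ABC [LHS]ec_addC ec_add_neg -[C]ec_negK -ABC ec_neg_add.
  by rewrite [ec_add (ec_neg A) _]ec_addC ec_addNKC ec_add_neg.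
have nBCA : ec_add B C != ec_neg A.
  apply: contraNneq nABC => /eqP; rewrite ec_add_eqr => /eqP ->.
  by rewrite ec_neg_add !ec_negK ec_addC.
case: (eqVneq (ec_add A B) C) => [ABC|ABC]; first by rewrite ABC; exact: ec_assoc_aux.
case: (eqVneq (ec_add B C) A) => [BCA|BCA]; last by apply: ec_assoc_sec.
rewrite BCA (@ec_assoc_aux C B A); last by rewrite ec_addC.
by rewrite ec_addC [ec_add B A]ec_addC.
Qed.

Lemma ec_addNr : left_inverse (ec_zero K) ec_neg (@ec_add K).
Proof. by move=> A; rewrite ec_addC ec_add_neg. Qed.

End GroupLaw.

(* The hypotheses are phantom arguments: the registered addition of [ecurve K] is
   a group law only under them, and [ecgroup] is convertible to [ecurve K]. *)
Definition ecgroup (K : fieldType) (two_neq0 : 2%:R != 0 :> K)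
  (three_neq0 : 3%:R != 0 :> K) : Type := ecurve K.

Section ZmodType.
Variables (K : fieldType) (two_neq0 : 2%:R != 0 :> K) (three_neq0 : 3%:R != 0 :> K).
HB.instance Definition _ := Choice.on (ecgroup two_neq0 three_neq0).
HB.instance Definition _ := GRing.isZmodule.Build (ecgroup two_neq0 three_neq0)
  (ec_addA two_neq0 three_neq0) (@ec_addC K) (@ec_add0 K) (@ec_addNr K).
End ZmodType.

(** * Supersingularity *)

Section Supersingular.
Variable K : fieldType.
Hypothesis five0 : 5%:R = 0 :> K.

Lemma char5_two_neq0 : 2%:R != 0 :> K.
Proof.
apply/eqP => two0; case/eqP: (oner_neq0 K).
have -> : 1 = 5 - 2 * 2 :> K by ring.
by rewrite five0 two0 mul0r subrr.
Qed.

Lemma char5_three_neq0 : 3%:R != 0 :> K.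
Proof.
apply/eqP => three0; case/eqP: (oner_neq0 K).
have -> : 1 = 2 * 3 - 5 :> K by ring.
by rewrite five0 three0 mulr0 subrr.
Qed.

(* [field] cannot use [5 = 0], so each identity below that holds only in
   characteristic 5 comes with an explicit multiple of [5] correcting it over [Z]. *)
Lemma char5_eq (a b w : K) : a = b + 5 * w -> a = b.
Proof. by rewrite five0 mul0r addr0. Qed.

Section Generic.
Variables x y u : K.
Hypotheses (x_u : x ^+ 3 = u - 1) (h : y ^+ 2 = u) (x25 : x ^+ 25 != x).
(** With [u = y ^+ 2], the polynomials [e] and [r] come from the numerators of [y(2 A)] and
    [x(4 A)], and [q] from the slope of the chord through [- F A] and [- A]. *)
Let e := 3 * u ^+ 2 - u - 1.
Let q := (u ^+ 4 + u ^+ 2 + 1) * (u ^+ 2 + 2 * u - 1).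
Let r := (u - 1) * (u + 1) ^+ 4 + 2 * (u + 1) * e ^+ 2.

Let two_neq0 := char5_two_neq0.
Let four_neq0 := four_neq0 two_neq0.

Let x25E : x ^+ 25 = x * (u - 1) ^+ 8.
Proof. by rewrite exprS (exprM x 3 8) x_u. Qed.

Let x_neq0 : x != 0.
Proof. by apply: contraNneq x25 => ->; rewrite expr0n. Qed.

Let w_neq0 : (u - 1) ^+ 8 - 1 != 0.
Proof.
apply: contraNneq x25 => /eqP; rewrite subr_eq0 x25E => /eqP ->.
by rewrite mulr1.
Qed.

Let u_neq0 : u != 0.
Proof.
apply: contraNneq w_neq0 => u0; apply/eqP.
apply: (@char5_eq _ _ (- (2 * u ^+ 7) + 5 * u ^+ 6 - 12 * u ^+ 5 + 14 * u ^+ 4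
  - 12 * u ^+ 3 + 5 * u ^+ 2 - 2 * u)).
by rewrite u0; ring.
Qed.

Let e_neq0 : e != 0.
Proof.
apply: contraNneq w_neq0 => e0; apply/eqP.
(* Modulo 5 the polynomial [e] divides [(u - 1) ^+ 8 - 1]: [2 A] can have order 2 only if [x] is
   fixed by the 25-power map. *)
rewrite [LHS](_ : _ =
    e * (2 * u ^+ 6 + 3 * u ^+ 5 + u ^+ 4 + u ^+ 3 + 4 * u ^+ 2 + 3 * u)
    + 5 * (- (u ^+ 8) - 3 * u ^+ 7 + 6 * u ^+ 6 - 11 * u ^+ 5 + 12 * u ^+ 4
           - 12 * u ^+ 3 + 7 * u ^+ 2 - u)); last by rewrite /e; ring.
by rewrite e0 five0 !mul0r addr0.
Qed.

Let y_neq0 : y != 0.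
Proof. by apply: contraNneq u_neq0 => y0; rewrite -h y0 expr0n. Qed.

Let dbl_x : tan_x x y = - x * (u + 1) / u.
Proof.
apply: (@char5_eq _ _ (x * (u - 1) / (4 * u))).
rewrite /tan_x /tslope; field: h x_u.
by rewrite ?oppr_eq0 ?x_neq0 ?y_neq0 ?u_neq0 ?e_neq0 ?two_neq0 ?four_neq0.
Qed.

Let dbl_y : tan_y x y = - y * e / u ^+ 2.
Proof.
apply: (@char5_eq _ _ ((2 * u ^+ 2 - u - 1) / (2 * y * u))).
rewrite /tan_y dbl_x /tslope /e; field: h x_u.
by rewrite ?oppr_eq0 ?x_neq0 ?y_neq0 ?u_neq0 ?e_neq0 ?two_neq0 ?four_neq0.
Qed.

Let dbl_y_neq0 : tan_y x y != 0.
Proof. by rewrite dbl_y !mulf_neq0 ?oppr_eq0 ?invr_eq0 ?expf_neq0. Qed.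

Let tslope2 : tslope (tan_x x y) (tan_y x y) = x ^+ 2 * (u + 1) ^+ 2 / (y * e).
Proof.
apply: (@char5_eq _ _ (- x ^+ 2 * (u + 1) ^+ 2 / (2 * y * e))).
rewrite /tslope dbl_x dbl_y; field: h.
by rewrite ?oppr_eq0 ?x_neq0 ?y_neq0 ?u_neq0 ?e_neq0 ?two_neq0 ?four_neq0.
Qed.

Let quad_x : tan_x (tan_x x y) (tan_y x y) = x * r / (u * e ^+ 2).
Proof.
rewrite {1}/tan_x tslope2 dbl_x /r; field: h x_u.
by rewrite ?oppr_eq0 ?x_neq0 ?y_neq0 ?u_neq0 ?e_neq0 ?two_neq0 ?four_neq0.
Qed.

Let frob_slope : slope (x ^+ 25) (- y * u ^+ 12) x (- y) =
  - y * (u - 1) * q / (2 * x * u * e).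
Proof.
apply: (@char5_eq _ _ (y * (u ^+ 15 + u ^+ 14 - 4 * u ^+ 13 + 2 * u ^+ 12
    + 12 * u ^+ 11 - 40 * u ^+ 10 + 71 * u ^+ 9 - 93 * u ^+ 8 + 104 * u ^+ 7
    - 104 * u ^+ 6 + 90 * u ^+ 5 - 62 * u ^+ 4 + 30 * u ^+ 3 - 10 * u ^+ 2 + 2 * u)
  / (2 * x * u * e * (1 - (u - 1) ^+ 8)))).
rewrite /slope x25E /q /e.
have w' : 1 - (u - 1) ^+ 8 != 0 by rewrite -opprB oppr_eq0.
have -> : x - x * (u - 1) ^+ 8 = x * (1 - (u - 1) ^+ 8) by ring.
field; rewrite -/e w' ?oppr_eq0 ?x_neq0.
by rewrite ?y_neq0 ?u_neq0 ?e_neq0 ?two_neq0 ?four_neq0.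
Qed.

Let frob_x : sec_x (x ^+ 25) (- y * u ^+ 12) x (- y) = x * r / (u * e ^+ 2).
Proof.
apply/esym; apply: (@char5_eq _ _ (x * (7 * u ^+ 13 - 63 * u ^+ 12 + 236 * u ^+ 11
    - 504 * u ^+ 10 + 648 * u ^+ 9 - 476 * u ^+ 8 + 122 * u ^+ 7 + 102 * u ^+ 6
    - 80 * u ^+ 5 + 32 * u ^+ 4 - 16 * u ^+ 3 - 8 * u ^+ 2 + 3 * u + 1)
  / (4 * u * e ^+ 2))).
rewrite /sec_x frob_slope x25E /q.
have -> : (- y * (u - 1) * ((u ^+ 4 + u ^+ 2 + 1) * (u ^+ 2 + 2 * u - 1)) / (2 * x * u * e)) ^+ 2
  = x * (u - 1) * ((u ^+ 4 + u ^+ 2 + 1) * (u ^+ 2 + 2 * u - 1)) ^+ 2 / (4 * u * e ^+ 2).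
  rewrite -x_u; field: h.
  by rewrite ?x_neq0 ?y_neq0 ?u_neq0 ?e_neq0 ?two_neq0 ?four_neq0.
rewrite /r /e; field.
by rewrite -/e ?oppr_eq0 ?x_neq0 ?y_neq0 ?u_neq0 ?e_neq0 ?two_neq0 ?four_neq0.
Qed.

Let quad_y : tan_y (tan_x x y) (tan_y x y) = sec_y (x ^+ 25) (- y * u ^+ 12) x (- y).
Proof.
have d : x - x ^+ 25 != 0 by rewrite subr_eq0 eq_sym.
have -> : sec_y (x ^+ 25) (- y * u ^+ 12) x (- y) =
   slope (x ^+ 25) (- y * u ^+ 12) x (- y) * (x - sec_x (x ^+ 25) (- y * u ^+ 12) x (- y)) - - y.
  by rewrite /sec_y /slope; field.
apply: (@char5_eq _ _ (y * (- (2 * u ^+ 12) - 5 * u ^+ 11 + 4 * u ^+ 10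
    + 7 * u ^+ 9 + 4 * u ^+ 8 - 45 * u ^+ 7 + 3 * u ^+ 6 + 73 * u ^+ 5 - 8 * u ^+ 4
    - 35 * u ^+ 3 - 2 * u ^+ 2 + 5 * u + 1) / (2 * u ^+ 2 * e ^+ 3))).
rewrite {1}/tan_y quad_x tslope2 frob_x frob_slope dbl_x dbl_y /q /r /e.
field: h x_u.
by rewrite -/e ?oppr_eq0 ?x_neq0 ?y_neq0 ?u_neq0 ?e_neq0 ?two_neq0 ?four_neq0.
Qed.

(* [4 A = - F A - A], with [F] the 25-power Frobenius and [y ^+ 25 = y * u ^+ 12]. *)
Lemma quad_frob (hy : y ^+ 2 = x ^+ 3 + 1)
    (hT : (- y * u ^+ 12) ^+ 2 = (x ^+ 25) ^+ 3 + 1) :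
  ec_add (ec_add (aff hy) (aff hy)) (ec_add (aff hy) (aff hy)) =
    ec_add (aff hT) (ec_neg (aff hy)).
Proof.
rewrite (add_tan two_neq0 hy y_neq0) (add_tan two_neq0 _ dbl_y_neq0).
have hy' : (- y) ^+ 2 = x ^+ 3 + 1 by rewrite sqrrN.
have -> : ec_neg (aff hy) = aff hy' by exact: val_inj.
have d : x - x ^+ 25 != 0 by rewrite subr_eq0 eq_sym.
by rewrite (add_sec _ _ d); apply: aff_inj; rewrite ?quad_x ?frob_x ?quad_y.
Qed.

End Generic.
End Supersingular.

(** * Frobenius and multiples *)

Section Map.
Variables (K L : fieldType) (f : {rmorphism K -> L}).

Lemma ec_map_subproof (A : ecurve K) :
  on_cubic (normal_rep (omap (fun xy => (f xy.1, f xy.2)) (val A))).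
Proof.
case: (ecP A) => [|x y h] /=; first by rewrite mulr0 !expr0n addr0.
by rewrite mulr1 expr1n -!rmorphXn h rmorphD rmorph1.
Qed.

Definition ec_map (A : ecurve K) : ecurve L := MkEcurve (ec_map_subproof A).

Lemma ec_mapD A B : ec_map (ec_add A B) = ec_add (ec_map A) (ec_map B).
Proof.
apply: val_inj; case: A => [[[x1 y1]|] hA]; case: B => [[[x2 y2]|] hB] //=.
rewrite -rmorphN !fmorph_eq; case: ifP => //= _.
by congr (Some (_, _)); case: ifP => _;
  rewrite !(rmorphB, rmorphM, rmorphXn, fmorphV, rmorph_nat).
Qed.

End Map.

Section Frobenius.
Variable K : fieldType.
Hypothesis five0 : 5%:R = 0 :> K.
Implicit Types A B : ecurve K.

Lemma char5P : 5%N \in [pchar K]%R.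
Proof. by rewrite inE /= five0 eqxx. Qed.

Definition frob25 : {rmorphism K -> K} :=
  (pFrobenius_aut char5P \o pFrobenius_aut char5P)%FUN.

Lemma frob25E x : frob25 x = x ^+ 25.
Proof. by rewrite /= !pFrobenius_autE -exprM. Qed.

Definition ec_frob := ec_map frob25.

Notation G := (ecgroup (char5_two_neq0 five0) (char5_three_neq0 five0)).

Lemma ec_frob_is_zmod_morphism : zmod_morphism (ec_frob : G -> G).
Proof.
move=> A B; apply: (addIr (ec_frob B : G)); rewrite subrK.
by rewrite -[LHS]ec_mapD -[X in ec_map _ X]/((A - B) + B : G) subrK.
Qed.

HB.instance Definition _ :=
  GRing.isZmodMorphism.Build G G (ec_frob : G -> G) ec_frob_is_zmod_morphism.

Lemma val_iter_frob k (A : G) :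
  val (iter k (ec_frob : G -> G) A) = omap (fun xy => (xy.1 ^+ (25 ^ k), xy.2 ^+ (25 ^ k))) (val A).
Proof.
elim: k => [|k IHk]; first by case: (val A) => [[]|].
rewrite iterS [LHS]/= [ec_val _]IHk; case: (val A) => [[x y]|] //=.
by rewrite !pFrobenius_autE -!exprM expnSr mulnA.
Qed.

(** The zero point gets the default value 0, so [xcoord] determines a point up to sign only away
    from zero. *)
Definition xcoord (A : ecurve K) : K := if val A is Some (x, _) then x else 0.

Lemma xcoord_inj (A B : G) : A != 0 -> B != 0 -> xcoord A = xcoord B -> A = B \/ A = - B.
Proof.
case: (ecP A) => [|x1 y1 h1]; first by rewrite eqxx.
case: (ecP B) => [|x2 y2 h2 _ _]; first by rewrite eqxx.
exact: aff_eqx.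
Qed.

(** Adding [A] to [4 A = - F A - A]; the hypothesis ensures that [- F A] and [- A] are joined by a
    genuine chord. *)
Lemma ec_mul5_frob (A : G) : xcoord A ^+ 25 != xcoord A -> A *+ 5 = - (ec_frob A : G).
Proof.
case: (ecP A) => [|x y h]; first by rewrite /xcoord /= expr0n eqxx.
rewrite /xcoord /= => x25.
have hT : (- y * (x ^+ 3 + 1) ^+ 12) ^+ 2 = (x ^+ 25) ^+ 3 + 1.
  have -> : (x ^+ 25) ^+ 3 + 1 = (x ^+ 3 + 1) ^+ 25.
    by rewrite -!frob25E rmorphD rmorphXn rmorph1.
  by rewrite -h; ring.
have := quad_frob five0 (u := x ^+ 3 + 1) (esym (addrK _ _)) h x25 h hT.
pose B : G := aff h; pose T : G := aff hT => e.
have {}e : (B + B) + (B + B) = T - B by exact: e.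
have TE : T = - (ec_frob B : G).
  apply: val_inj; rewrite /= !pFrobenius_autE -!exprM; congr (Some (_, _)).
  by rewrite -h -exprM mulNr -exprS.
by rewrite -/B -TE -[RHS](subrK B) -e !mulrS mulr0n addr0 !addrA.
Qed.

Section NonTorsion.
Variable A : G.
(** This says that the abscissa of [A] is transcendental over the prime field. *)
Hypothesis A_inj : injective (fun k => xcoord A ^+ (25 ^ k)).

Let x25 : xcoord A ^+ 25 != xcoord A.
Proof. by apply/negP => /eqP e; have /A_inj : xcoord A ^+ (25 ^ 1) = xcoord A ^+ (25 ^ 0). Qed.

Lemma iter_frob_mulz k : iter k (ec_frob : G -> G) A = A *~ ((- 5) ^+ k).
Proof.
elim: k => [|k IHk]; first by rewrite expr0 mulr1z.
rewrite iterS IHk raddfMz exprSr mulrC mulrzA; congr (_ *~ _).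
by rewrite mulrNz -[X in - X]/(A *+ 5) ec_mul5_frob // opprK.
Qed.

Lemma mulrn_frob k : A *+ (25 ^ k) = iter k.*2 (ec_frob : G -> G) A.
Proof. by rewrite iter_frob_mulz -mul2n exprM sqrrN pmulrn -natz natrX. Qed.

Lemma mulrn_frob2 i j :
  A *+ (25 ^ i + 25 ^ j) = iter i.*2 (ec_frob : G -> G) A + iter j.*2 (ec_frob : G -> G) A.
Proof. by rewrite mulrnDr !mulrn_frob. Qed.

Lemma xcoord_iter_frob k : xcoord (iter k (ec_frob : G -> G) A) = xcoord A ^+ (25 ^ k).
Proof.
have := val_iter_frob k A; rewrite /xcoord => ->; case: (val A) => [[x y]|] //=.
by rewrite expr0n expn_eq0.
Qed.

(* The multiples [A *+ 25 ^ k], being conjugate under Frobenius, are pairwise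
   distinct, whereas a torsion point has only finitely many multiples. *)
Lemma mulz_neq0 m : m != 0 -> A *~ m != 0.
Proof.
move=> m0; apply/eqP => Am; pose n := `|m|%N.
have n_gt0 : (0 < n)%N by rewrite absz_gt0.
have An : A *+ n = 0.
  rewrite pmulrn; have [->|->] : n%:Z = m \/ n%:Z = - m by rewrite /n; lia.
    exact: Am.
  by rewrite mulrNz Am oppr0.
have Amod k : A *+ k = A *+ (k %% n).
  by rewrite {1}(divn_eq k n) mulrnDr mulnC mulrnA An mul0rn add0r.
pose f (k : 'I_n.+1) : 'I_n := Ordinal (ltn_pmod (25 ^ k) n_gt0).
suff /leq_card : injective f by rewrite !card_ord ltnn.
move=> k l [e]; apply/val_inj/double_inj/A_inj => /=.
by rewrite -!xcoord_iter_frob -!mulrn_frob Amod e -Amod.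
Qed.

Lemma xcoord_mulz_inj m n :
  m != 0 -> n != 0 -> xcoord (A *~ m) = xcoord (A *~ n) -> m = n \/ m = - n.
Proof.
move=> m0 n0 /(xcoord_inj (mulz_neq0 m0) (mulz_neq0 n0)) [] e; [left|right]; apply/eqP.
  rewrite -subr_eq0; apply: contraTT isT => /mulz_neq0.
  by rewrite mulrzBr e subrr eqxx.
rewrite -addr_eq0; apply: contraTT isT => /mulz_neq0.
by rewrite mulrzDr e addNr eqxx.
Qed.

End NonTorsion.

End Frobenius.

(** * Derivations of rational functions *)

Section Derivation.
Variables (F K : fieldType) (ev : {rmorphism {poly F} -> K}).
Hypothesis ev_inj : injective ev.
Implicit Types (p q : {poly F}) (f g : K).

(* A relation and not a map: when [K] is perfect it has no nonzero derivation,
   and only the image of the field of fractions of [{poly F}] carries [d/dX]. *)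
Definition der f f' := exists p q, [/\ ev q != 0, f = ev p / ev q &
  f' = (ev p^`() * ev q - ev p * ev q^`()) / ev q ^+ 2].

(** Injectivity of [ev] lifts equality of two fractions to [p1 * q2 = p2 * q1] in [{poly F}];
    differentiating this identity equates the two quotient rules. *)
Lemma der_uniq f f1 f2 : der f f1 -> der f f2 -> f1 = f2.
Proof.
move=> [p1 [q1 [q10 -> ->]]] [p2 [q2 [q20 e ->]]].
have {}e : p1 * q2 = p2 * q1.
  by apply: ev_inj; rewrite !rmorphM; apply/eqP; rewrite -eqr_div // e.
have de := congr1 (fun p => ev p^`()) e; have {}e := congr1 ev e.
move: de e; rewrite !derivM !rmorphD !rmorphM /= => de e.
have P1 : ev p1 = ev p2 * ev q1 / ev q2 by rewrite -e mulfK.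
have dP1 : ev p1^`() = (ev p2^`() * ev q1 + ev p2 * ev q1^`() - ev p1 * ev q2^`()) / ev q2.
  by rewrite -de addrK mulfK.
by rewrite dP1 P1; field; rewrite q10 q20.
Qed.

Lemma der_ev p : der (ev p) (ev p^`()).
Proof.
exists p, 1; rewrite rmorph1 oner_neq0 derivC rmorph0 divr1 mulr1 mulr0 subr0.
by rewrite expr1n divr1.
Qed.

Lemma derD f f' g g' : der f f' -> der g g' -> der (f + g) (f' + g').
Proof.
move=> [p1 [q1 [q10 -> ->]]] [p2 [q2 [q20 -> ->]]].
exists (p1 * q2 + p2 * q1), (q1 * q2).
rewrite !derivD !derivM !rmorphD !rmorphM /= mulf_neq0 //.
by split=> //; rewrite ?rmorphD ?rmorphM; field; rewrite q10 q20.
Qed.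

Lemma derM f f' g g' : der f f' -> der g g' -> der (f * g) (f' * g + f * g').
Proof.
move=> [p1 [q1 [q10 -> ->]]] [p2 [q2 [q20 -> ->]]].
exists (p1 * p2), (q1 * q2).
rewrite !derivM !rmorphD !rmorphM /= mulf_neq0 //.
by split=> //; field; rewrite q10 q20.
Qed.

Lemma derN f f' : der f f' -> der (- f) (- f').
Proof.
move=> [p1 [q1 [q10 -> ->]]]; exists (- p1), q1.
by rewrite derivN !rmorphN; split=> //; field.
Qed.

Lemma derV f f' : f != 0 -> der f f' -> der f^-1 (- f' / f ^+ 2).
Proof.
move=> f0 [p [q [q0 fE ->]]].
have p0 : ev p != 0 by apply: contraNneq f0 => p0; rewrite fE p0 mul0r.
by exists q, p; rewrite fE; split=> //; field; rewrite p0 q0.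
Qed.

Lemma der_eq f f' g g' : der f f' -> f = g -> f' = g' -> der g g'.
Proof. by move=> d <- <-. Qed.

Lemma der1 : der 1 0.
Proof. by have := der_ev 1; rewrite derivC rmorph1 rmorph0. Qed.

Lemma der0 : der 0 0.
Proof. by have := der_ev 0; rewrite derivC rmorph0. Qed.

Lemma derX f f' n : der f f' -> der (f ^+ n) (n%:R * f ^+ n.-1 * f').
Proof.
move=> df; elim: n => [|n IHn]; first by rewrite !mul0r; exact: der1.
apply: der_eq (derM df IHn) _ _; first by rewrite exprS.
by case: n {IHn} => [|n]; rewrite -?natr1 /= ?exprS; ring.
Qed.

Lemma derX0 f f' n : n%:R = 0 :> K -> der f f' -> der (f ^+ n) 0.
Proof. by move=> n0 /(derX n); rewrite n0 !mul0r. Qed.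

Definition rational f := exists f', der f f'.

Lemma rationalD f g : rational f -> rational g -> rational (f + g).
Proof. by move=> [f' df] [g' dg]; exists (f' + g'); exact: derD. Qed.
Lemma rationalN f : rational f -> rational (- f).
Proof. by move=> [f' df]; exists (- f'); exact: derN. Qed.
Lemma rationalB f g : rational f -> rational g -> rational (f - g).
Proof. by move=> df dg; apply: rationalD => //; exact: rationalN. Qed.
Lemma rationalM f g : rational f -> rational g -> rational (f * g).
Proof. by move=> [f' df] [g' dg]; eexists; exact: derM df dg. Qed.
Lemma rationalX f n : rational f -> rational (f ^+ n).
Proof. by move=> [f' df]; eexists; exact: derX df. Qed.
Lemma rationalV f : rational f -> rational f^-1.
Proof.
have [->|f0] := eqVneq f 0; first by rewrite invr0.
by move=> [f' df]; eexists; exact: derV df.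
Qed.
Lemma rational_ev p : rational (ev p).
Proof. by eexists; exact: der_ev. Qed.
Lemma rational_nat n : rational n%:R.
Proof. by rewrite -(rmorph_nat ev); exact: rational_ev. Qed.

Ltac rat := repeat first [assumption | exact: rational_nat | apply: rationalM
  | apply: rationalB | apply: rationalD | apply: rationalN | apply: rationalV
  | apply: rationalX].

Section Points.
Hypothesis five0 : 5%:R = 0 :> K.
Notation G := (ecgroup (char5_two_neq0 five0) (char5_three_neq0 five0)).
Variables (w s : K) (A : G).
Hypotheses (dw : der w 1) (Aval : val (A : ecurve K) = Some (w, s)).

(** Besides zero, these are the points [(f, s * r)] coming from the quadratic twist by [s ^+ 2] over
    the rational functions. They form a subgroup containing [A], and their abscissas can be
    differentiated although [s] cannot. *)
Definition rational_point (B : G) :=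
  if val (B : ecurve K) is Some (f, y) then rational f /\ exists2 r, rational r & y = s * r
  else True.

Let hs : s ^+ 2 = w ^+ 3 + 1.
Proof. by move: Aval; case: (ecP A) => //= x y h [<- <-]. Qed.

Let dg : der (w ^+ 3 + 1) (3 * w ^+ 2).
Proof. by apply: der_eq (derD (derX 3 dw) der1) _ _ => //=; rewrite mulr1 addr0. Qed.

Let two0 := char5_two_neq0 five0.
Let three0 := char5_three_neq0 five0.

Let g0 : w ^+ 3 + 1 != 0.
Proof.
apply/eqP => e; have dg0 := dg; rewrite e in dg0.
have /eqP := der_uniq dg0 der0; rewrite mulf_eq0 (negPf three0) expf_eq0 /= => /eqP w0.
by move/eqP: e; rewrite w0 expr0n add0r oner_eq0.
Qed.

Let sV : s^-1 = s / (w ^+ 3 + 1).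
Proof.
have s0 : s != 0 by apply: contraNneq g0 => s0; rewrite -hs s0 expr0n.
by rewrite -hs; field.
Qed.

Let rat_g : rational (w ^+ 3 + 1).
Proof. by eexists; exact: dg. Qed.

Lemma rational_pointD B C :
  rational_point B -> rational_point C -> rational_point (B + C).
Proof.
case: (ecP B) => [|x1 y1 h1]; case: (ecP C) => [|x2 y2 h2] //=.
rewrite /rational_point /=.
move=> [rx1 [r1 rr1 ->]] [rx2 [r2 rr2 ->]]; case: ifP => // _.
set l := if _ then _ else _.
(* The slope is [s] times a rational function, so its square is rational. *)
have [m rm ->] : exists2 m, rational m & l = s * m.
  rewrite /l; case: ifP => _.
    exists (3 * x1 ^+ 2 / 2 / (w ^+ 3 + 1) / r1).
      by rat.
    by rewrite !invfM sV; ring.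
  exists ((r2 - r1) / (x2 - x1)); last by ring.
  by rat.
have rx3 : rational ((s * m) ^+ 2 - x1 - x2).
  by rewrite exprMn hs; rat.
split=> //; exists (m * (x1 - ((s * m) ^+ 2 - x1 - x2)) - r1); last by ring.
by rat.
Qed.

Lemma rational_pointN B : rational_point B -> rational_point (- B).
Proof.
case: (ecP B) => [|x1 y1 h1] //; rewrite /rational_point /= => - [rx1 [r1 rr1 ->]]; split=> //.
by exists (- r1); [exact: rationalN | rewrite mulrN].
Qed.

Lemma rational_point_mulz m : rational_point (A *~ m).
Proof.
have rA : rational_point A.
  rewrite /rational_point Aval; split; first by exists 1.
  by exists 1; [exact: (rational_nat 1) | rewrite mulr1].
have rn n : rational_point (A *+ n).
  by elim: n => [//|n IHn]; rewrite mulrS; exact: rational_pointD.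
by case: (intP m) => [|n|n]; rewrite ?mulrNz; do ?[apply: rational_pointN]; exact: rn.
Qed.

(* The invariant differential [dx / y] is preserved by [B |-> A + B] for [B]
   constant, and Frobenius makes the coordinates of any point constant. *)
Lemma der_xcoord_frob B : rational_point B ->
  exists2 f', der (xcoord (A + (ec_frob five0 B : G))) f' &
    f' ^+ 2 * (w ^+ 3 + 1) = xcoord (A + (ec_frob five0 B : G)) ^+ 3 + 1.
Proof.
rewrite /rational_point; case: (ecP B) => [_|x0 y0 h0 [/= [x0' dx0] [r0 [r0' dr0] y0E]]].
  have -> : (ec_frob five0 (ec_zero K) : G) = 0 by exact: val_inj.
  rewrite addr0 /xcoord Aval; exists 1; first exact: dw.
  by rewrite expr1n mul1r.
pose g := w ^+ 3 + 1.
(* The Frobenius image of [B] is [(c, s * r)], because [s ^+ 25 = s * g ^+ 12]. Constancy of [s * r]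
   is expressed by the logarithmic derivative of [r] in [dr]. *)
pose c := x0 ^+ 25; pose r := g ^+ 12 * r0 ^+ 25.
have dc : der c 0 by apply: derX0 dx0; rewrite (natrM _ 5 5) five0 mul0r.
have dr : der r (- (3 / 2) * w ^+ 2 * r / g).
  have d25 : der (r0 ^+ 25) 0 by apply: derX0 dr0; rewrite (natrM _ 5 5) five0 mul0r.
  apply: der_eq (derM (derX 12 dg) d25) _ _ => //.
  rewrite mulr0 addr0 /=.
  apply: (char5_eq five0 (w := 15 / 2 * w ^+ 2 * g ^+ 11 * r0 ^+ 25)).
  by rewrite /r /g; field; rewrite g0 two0.
have hr : g * r ^+ 2 = c ^+ 3 + 1.
  rewrite /c -[_ ^+ 25](frob25E five0) -rmorphXn -(rmorph1 (frob25 five0)) -rmorphD frob25E.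
  by rewrite -h0 y0E /r /g -hs; ring.
have cw : c - w != 0.
  apply/eqP => /eqP; rewrite subr_eq0 => /eqP e; have := der_uniq dc; rewrite e => /(_ _ dw).
  by move/eqP; rewrite eq_sym oner_eq0.
have hc : (s * r) ^+ 2 = c ^+ 3 + 1 by rewrite exprMn hs.
have -> : (ec_frob five0 (aff h0) : G) = aff hc.
  apply: val_inj => /=; rewrite !pFrobenius_autE -!exprM.
  congr (Some (_, _)).
  rewrite y0E /r /g -hs; ring.
have -> : A = aff hs by exact: val_inj.
have -> : (aff hs : G) + (aff hc : G) = aff (secP hs hc cw) by exact: add_sec.
have -> : xcoord (aff (secP hs hc cw)) = sec_x w s c (s * r) by [].
pose l := (r - 1) / (c - w).
have slopeE : slope w s c (s * r) = s * l by rewrite /slope /l; ring.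
have fE : sec_x w s c (s * r) = g * l ^+ 2 - w - c.
  by rewrite /sec_x slopeE exprMn hs.
(* This witness is [sec_y / s], the derivative predicted by invariance of [dx / y]. *)
exists (l * (w - sec_x w s c (s * r)) - 1); last first.
  by rewrite -(secP hs hc cw) /sec_y slopeE -hs; ring.
have dl := derM (derD dr (derN der1)) (derV cw (derD dc (derN dw))).
apply: der_eq (derD (derD (derM dg (derX 2 dl)) (derN dw)) (derN dc)) _ _.
  by rewrite fE.
rewrite fE /l /= /g.
have c3 : c ^+ 3 = (w ^+ 3 + 1) * r ^+ 2 - 1 by rewrite hr addrK.
by field: c3; rewrite g0 cw two0.
Qed.

End Points.

End Derivation.

(** * Regular functions and elimination *)

Section Regular.
Variable K : fieldType.
Implicit Types (p : {mpoly K[8]}) (f g : Gm2E2 K -> K).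

(** Fixing both degrees lets them be tracked through sums and products; the zero polynomial has
    every bidegree. *)
Definition bidegree d e p := forall m : 'X_{1..8}, m \in msupp p ->
  (\sum_(i < 8 | 2 <= i < 5) m i = d)%N /\ (\sum_(i < 8 | 5 <= i) m i = e)%N.

Definition regular d e f :=
  exists2 p, bidegree d e p & forall w, p.@[tnth (coords w)] = f w.

Lemma regularD d e f g :
  regular d e f -> regular d e g -> regular d e (fun w => f w + g w).
Proof.
move=> [p hp pE] [q hq qE]; exists (p + q) => [m /msuppD_le|w]; last by rewrite mevalD pE qE.
by rewrite mem_cat => /orP[/hp|/hq].
Qed.

Lemma regularM d e d' e' f g : regular d e f -> regular d' e' g ->
  regular (d + d') (e + e') (fun w => f w * g w).
Proof.
move=> [p hp pE] [q hq qE]; exists (p * q) => [m /msuppM_le|w]; last by rewrite mevalM pE qE.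
case/allpairsP => -[m1 m2] /= [/hp [<- <-] /hq [<- <-] ->].
by rewrite -!big_split; split; apply: eq_bigr => i _; rewrite mnmDE.
Qed.

Lemma regularC c : regular 0 0 (fun=> c).
Proof.
exists c%:MP_[8] => [m|w]; last by rewrite mevalC.
rewrite msuppC; case: eqP => // _; rewrite inE => /eqP ->.
by split; apply: big1 => i _; rewrite mnm0E.
Qed.

Lemma regularN d e f : regular d e f -> regular d e (fun w => - f w).
Proof.
move=> [p hp pE]; exists (- p) => [m|w]; last by rewrite mevalN pE.
by rewrite (perm_mem (msuppN p)); exact: hp.
Qed.

Lemma regularX (i : 'I_8) :
  regular (2 <= i < 5)%N (5 <= i)%N (fun w => tnth (coords w) i).
Proof.
exists 'X_i => [m|w]; last by rewrite mevalXU.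
rewrite msuppX inE => /eqP ->.
have E (P : pred 'I_8) : (\sum_(k < 8 | P k) U_(i)%MM k = P i)%N.
  case Pi : (P i).
    by rewrite (bigD1 i) //= mnm1E eqxx big1 // => k /andP[_ /negPf ki]; rewrite mnm1E eq_sym ki.
  by rewrite big1 // => k Pk; rewrite mnm1E; case: eqP => // ik; rewrite ik Pk in Pi.
by rewrite !E.
Qed.

Lemma closed_regular d e f : regular d e f -> closed_subvariety [set w | f w = 0]%classic.
Proof.
move=> [p hp pE]; exists [:: p]; first by move=> q; rewrite inE => /eqP ->; exists d, e.
apply/seteqP; split=> w /=.
  by move=> fw q; rewrite inE => /eqP ->; rewrite pE.
by move=> /(_ p); rewrite inE eqxx pE => ->.
Qed.

End Regular.

(* [chA Z^2 + chB Z + chC = 0] is the equation relating the [x]-coordinates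
   [X], [x0 / x2] and [Z] of three points of the curve with sum zero, and
   [elimZ] is the resultant in [Z] of this equation and of the one for [X + 1],
   [y0 / y2], [Z + 1]. The product is a parameter because the formula is used in
   [K] and in [K[X]/(X^2 - e1 X + e2)]. *)
Section Elimination.
Variables (T : zmodType) (mul : T -> T -> T).
Local Notation "a ** b" := (mul a b) (at level 40, left associativity).

Definition chA X x0 x2 := (X ** x2 - x0) ** (X ** x2 - x0).
Definition chB X x0 x2 := - ((X ** x0 ** (X ** x2 + x0) + (x2 ** x2) *+ 2) *+ 2).
Definition chC X x0 x2 := X ** x0 ** (X ** x0) - (x0 ** x2) *+ 4 - (X ** x2 ** x2) *+ 4.

(** The closed form of the resultant of two quadratics. In [elimZ] the second one is
    [a (Z + 1)^2 + b (Z + 1) + c], expanded in [Z]. *)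
Definition quad_res a b c a' b' c' :=
  (a ** c' - c ** a') ** (a ** c' - c ** a') - (a ** b' - b ** a') ** (b ** c' - c ** b').

Definition elimZ one X x0 x2 y0 y2 :=
  let a := chA (X + one) y0 y2 in let b := chB (X + one) y0 y2 in
  let c := chC (X + one) y0 y2 in
  quad_res (chA X x0 x2) (chB X x0 x2) (chC X x0 x2) a (a *+ 2 + b) (a + b + c).

End Elimination.

(** With [h] the evaluation at a root, this carries the computation in the quadratic algebra over to
    [K]. *)
Lemma elimZ_morph (T T' : zmodType) mul mul' (h : {additive T -> T'}) :
  (forall a b, h (mul a b) = mul' (h a) (h b)) -> forall one X x0 x2 y0 y2,
  h (elimZ mul one X x0 x2 y0 y2) = elimZ mul' (h one) (h X) (h x0) (h x2) (h y0) (h y2).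
Proof.
move=> hM one X x0 x2 y0 y2.
by rewrite /elimZ /quad_res /chA /chB /chC; do !rewrite ?raddfB ?raddfD ?raddfN ?raddfMn ?hM /=.
Qed.

(** * The quadratic algebra of the two roots and the equation of V *)

Section Quadratic.
Variable K : fieldType.

(* [(a, b)] stands for the class of [a + b X] modulo [X^2 - e1 X + e2]. *)
Definition qmul (e1 e2 : K) (a b : K * K) : K * K :=
  (a.1 * b.1 - a.2 * b.2 * e2, a.1 * b.2 + a.2 * b.1 + a.2 * b.2 * e1).

Definition qeval (X : K) (a : K * K) := a.1 + a.2 * X.

Lemma qeval_is_zmod_morphism X : zmod_morphism (qeval X).
Proof. by move=> a b; rewrite /qeval /=; ring. Qed.

HB.instance Definition _ X :=
  GRing.isZmodMorphism.Build (K * K)%type K (qeval X) (qeval_is_zmod_morphism X).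

(** The norm down to [K]: the product of the values at both roots is symmetric in them, hence
    polynomial in [e1] and [e2]. *)
Definition qnorm (e1 e2 : K) (a : K * K) := a.1 * a.1 + a.1 * a.2 * e1 + a.2 * a.2 * e2.

Lemma qnormE X Y a : qnorm (X + Y) (X * Y) a = qeval X a * qeval Y a.
Proof. by rewrite /qnorm /qeval; ring. Qed.

Lemma qevalM X Y a b : qeval X (qmul (X + Y) (X * Y) a b) = qeval X a * qeval X b.
Proof. by rewrite /qmul /qeval /=; ring. Qed.

(** The intended points have [u = (X + 1) (Y + 1)] and [v = X Y], hence [X + Y = u - v - 1]. The
    factor [P], whose abscissas are shifted by 1, supplies the second equation of [elimZ]. *)
Definition qelim (w : Gm2E2 K) : K * K :=
  let: (u, v, P, Q) := w in
  let: (y0, _, y2) := hcoord P in let: (x0, _, x2) := hcoord Q in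
  elimZ (qmul (gm_val u - gm_val v - 1) (gm_val v)) (1, 0) (0, 1) (x0, 0) (x2, 0) (y0, 0) (y2, 0).

Definition qelim_norm (w : Gm2E2 K) : K :=
  let: (u, v, _, _) := w in qnorm (gm_val u - gm_val v - 1) (gm_val v) (qelim w).

Lemma qelim_normE (u v : Gm K) (P Q : ecurve K) X Y x1 y1 x2 y2 :
  gm_val u - gm_val v - 1 = X + Y -> gm_val v = X * Y ->
  val P = Some (x1, y1) -> val Q = Some (x2, y2) ->
  qelim_norm (u, v, P, Q) =
    elimZ *%R 1 X x2 1 x1 1 * elimZ *%R 1 Y x2 1 x1 1.
Proof.
move=> uE vE PE QE; rewrite /qelim_norm /qelim /hcoord PE QE /= uE vE qnormE.
have E Z : forall c, qeval Z (c, 0) = c by move=> c; rewrite /qeval mul0r addr0.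
have EX Z : qeval Z (0, 1) = Z by rewrite /qeval mul1r add0r.
congr (_ * _).
  rewrite (elimZ_morph (h := qeval X) (mul' := *%R)); last exact: qevalM.
  by rewrite /= !E EX.
rewrite [X + Y]addrC [X * Y]mulrC.
rewrite (elimZ_morph (h := qeval Y) (mul' := *%R)); last exact: qevalM.
by rewrite /= !E EX.
Qed.

Definition regular2 d e (f : Gm2E2 K -> K * K) :=
  regular d e (fun w => (f w).1) /\ regular d e (fun w => (f w).2).

Let e1 (w : Gm2E2 K) : K := gm_val w.1.1.1 - gm_val w.1.1.2 - 1.
Let e2 (w : Gm2E2 K) : K := gm_val w.1.1.2.

Lemma regular_coord (i : 'I_8) (f : Gm2E2 K -> K) :
  (forall w, tnth (coords w) i = f w) -> regular (2 <= i < 5)%N (5 <= i)%N f.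
Proof. by move=> fE; have [p hp pE] := regularX K i; exists p => // w; rewrite pE. Qed.

Lemma coordsE (w : Gm2E2 K) :
  coords w = [tuple gm_val w.1.1.1; gm_val w.1.1.2;
    (hcoord w.1.2).1.1; (hcoord w.1.2).1.2; (hcoord w.1.2).2;
    (hcoord w.2).1.1; (hcoord w.2).1.2; (hcoord w.2).2].
Proof.
move: w => [[[u v] P] Q]; rewrite /coords /=.
by case: (hcoord P) => [[x0 x1] x2]; case: (hcoord Q) => [[y0 y1] y2].
Qed.

Let regular_e2 : regular 0 0 e2.
Proof. by apply: (regular_coord (i := @Ordinal 8 1 isT)) => w; rewrite coordsE. Qed.

Let regular_e1 : regular 0 0 e1.
Proof.
do 2?[apply: regularD]; last by apply: regularN; exact: regularC.
  by apply: (regular_coord (i := @Ordinal 8 0 isT)) => w; rewrite coordsE.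
exact: regularN regular_e2.
Qed.

Lemma regular2D d e f g :
  regular2 d e f -> regular2 d e g -> regular2 d e (fun w => f w + g w).
Proof. by move=> [f1 f2] [g1 g2]; split; apply: regularD. Qed.

Lemma regular2N d e f : regular2 d e f -> regular2 d e (fun w => - f w).
Proof. by move=> [f1 f2]; split; apply: regularN. Qed.

Lemma regular2Mn d e f n : regular2 d e f -> regular2 d e (fun w => f w *+ n.+1).
Proof. by elim: n => [//|n IHn] hf; apply: regular2D => //; exact: IHn. Qed.

Lemma regular2M d e d' e' f g : regular2 d e f -> regular2 d' e' g ->
  regular2 (d + d') (e + e') (fun w => qmul (e1 w) (e2 w) (f w) (g w)).
Proof.
have addE n : n = (n + 0)%N by rewrite addn0.
move=> [f1 f2] [g1 g2]; split; rewrite /qmul /=.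
  apply: regularD; first exact: regularM.
  apply: regularN; rewrite [(d + _)%N]addE [(e + _)%N]addE.
  exact: regularM (regularM f2 g2) regular_e2.
do 2?apply: regularD; do 1?exact: regularM.
by rewrite [(d + _)%N]addE [(e + _)%N]addE; exact: regularM (regularM f2 g2) regular_e1.
Qed.

Lemma regular2_cst d e f : regular d e f -> regular2 d e (fun w => (f w, 0)).
Proof. by move=> hf; split=> //; exists 0 => [m|w]; rewrite ?msupp0 ?meval0. Qed.

Lemma regular2_elim dx ex dy ey one X x0 x2 y0 y2 :
  regular2 0 0 one -> regular2 0 0 X -> regular2 dx ex x0 -> regular2 dx ex x2 ->
  regular2 dy ey y0 -> regular2 dy ey y2 ->
  exists d e, regular2 d e (fun w => elimZ (qmul (e1 w) (e2 w))
    (one w) (X w) (x0 w) (x2 w) (y0 w) (y2 w)).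
Proof.
have RA d e Y z0 z2 : regular2 0 0 Y -> regular2 d e z0 -> regular2 d e z2 ->
    regular2 (d + d) (e + e) (fun w => chA (qmul (e1 w) (e2 w)) (Y w) (z0 w) (z2 w)).
  move=> hY h0 h2; have h := regular2D (regular2M hY h2) (regular2N h0).
  exact: (regular2M h h).
have RB d e Y z0 z2 : regular2 0 0 Y -> regular2 d e z0 -> regular2 d e z2 ->
    regular2 (d + d) (e + e) (fun w => chB (qmul (e1 w) (e2 w)) (Y w) (z0 w) (z2 w)).
  move=> hY h0 h2; apply: regular2N; apply: regular2Mn; apply: regular2D.
    by apply: regular2M; [exact: (regular2M hY) | apply: regular2D => //; exact: (regular2M hY)].
  by apply: regular2Mn; apply: regular2M.
have RC d e Y z0 z2 : regular2 0 0 Y -> regular2 d e z0 -> regular2 d e z2 ->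
    regular2 (d + d) (e + e) (fun w => chC (qmul (e1 w) (e2 w)) (Y w) (z0 w) (z2 w)).
  move=> hY h0 h2; apply: regular2D; first apply: regular2D.
  - by apply: regular2M; exact: (regular2M hY).
  - by apply: regular2N; apply: regular2Mn; apply: regular2M.
  by apply: regular2N; apply: regular2Mn; apply: regular2M => //; exact: (regular2M hY).
move=> h1 hX hx0 hx2 hy0 hy2; have hY := regular2D hX h1.
do 2!eexists; rewrite /elimZ /quad_res.
have A := RA _ _ _ _ _ hX hx0 hx2; have B := RB _ _ _ _ _ hX hx0 hx2.
have C := RC _ _ _ _ _ hX hx0 hx2.
have A' := RA _ _ _ _ _ hY hy0 hy2; have B' := RB _ _ _ _ _ hY hy0 hy2.
have C' := RC _ _ _ _ _ hY hy0 hy2.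
have B2 := regular2D (regular2Mn 1 A') B'; have C2 := regular2D (regular2D A' B') C'.
have ac := regular2D (regular2M A C2) (regular2N (regular2M C A')).
have ab := regular2D (regular2M A B2) (regular2N (regular2M B A')).
have bc := regular2D (regular2M B C2) (regular2N (regular2M C B2)).
exact: regular2D (regular2M ac ac) (regular2N (regular2M ab bc)).
Qed.

Lemma closed_qelim_norm : closed_subvariety [set w | qelim_norm w = 0]%classic.
Proof.
have [||||||d [e]] := @regular2_elim 0 1 1 0 (fun=> (1, 0)) (fun=> (0, 1))
  (fun w => ((hcoord w.2).1.1, 0)) (fun w => ((hcoord w.2).2, 0))
  (fun w => ((hcoord w.1.2).1.1, 0)) (fun w => ((hcoord w.1.2).2, 0)).
- by apply: regular2_cst; exact: regularC.
- by split; exact: regularC.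
- by apply/regular2_cst/(regular_coord (i := @Ordinal 8 5 isT)) => w; rewrite coordsE.
- by apply/regular2_cst/(regular_coord (i := @Ordinal 8 7 isT)) => w; rewrite coordsE.
- by apply/regular2_cst/(regular_coord (i := @Ordinal 8 2 isT)) => w; rewrite coordsE.
- by apply/regular2_cst/(regular_coord (i := @Ordinal 8 4 isT)) => w; rewrite coordsE.
set f := (fun w => elimZ _ _ _ _ _ _ _) => -[f1 f2].
have fE w : qelim w = f w.
  move: w => [[[u v] P] Q]; rewrite /qelim /f /e1 /e2 /=.
  by case: (hcoord P) => [[y0 y1] y2]; case: (hcoord Q) => [[x0 x1] x2].
have addE n : n = (n + 0)%N by rewrite addn0.
apply: (@closed_regular _ (d + d) (e + e)).
suff [p hp pE] : regular (d + d) (e + e) (fun w => qnorm (e1 w) (e2 w) (f w)).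
  by exists p => // -[[[u v] P] Q]; rewrite pE /qelim_norm fE.
apply: regularD; first apply: regularD; first exact: regularM.
  by rewrite [(d + _)%N]addE [(e + _)%N]addE; exact: regularM (regularM f1 f2) regular_e1.
by rewrite [(d + _)%N]addE [(e + _)%N]addE; exact: regularM (regularM f2 f2) regular_e2.
Qed.

End Quadratic.

(** Stated without group axioms, since [ecurve K] is registered with an addition and a zero only. *)
Lemma pair_mulrn (M N : Algebra.BaseAddUMagma.type) (a : M) (b : N) n :
  (a, b) *+ n = (a *+ n, b *+ n).
Proof.
case: n => [//|n]; elim: n => [//|n IHn].
by rewrite -[LHS]/((a, b) + (a, b) *+ n.+1) IHn.
Qed.

(** * Abscissas of sums and vanishing of the resultant *)

Section Chords.
Variable K : fieldType.
Implicit Types x y z : K.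
Local Notation mul := (@GRing.mul K).

Lemma quad_res_common_root a b c a' b' c' z :
  a * z ^+ 2 + b * z + c = 0 -> a' * z ^+ 2 + b' * z + c' = 0 ->
  quad_res mul a b c a' b' c' = 0.
Proof.
move=> e e'; have -> : c = - (a * z ^+ 2 + b * z) by rewrite -[LHS]subr0 -e; ring.
have -> : c' = - (a' * z ^+ 2 + b' * z) by rewrite -[LHS]subr0 -e'; ring.
by rewrite /quad_res; ring.
Qed.

(** The product formula for the resultant, from which a coincidence of roots is read off. *)
Lemma quad_res_factor a z1 z2 a' z1' z2' :
  quad_res mul a (- a * (z1 + z2)) (a * (z1 * z2)) a' (- a' * (z1' + z2')) (a' * (z1' * z2')) =
  (a * a') ^+ 2 * ((z1 - z1') * (z1 - z2') * (z2 - z1') * (z2 - z2')).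
Proof. rewrite /quad_res; ring. Qed.

Section Sum.
Variables (x1 y1 x2 y2 : K).
Hypotheses (h1 : y1 ^+ 2 = x1 ^+ 3 + 1) (h2 : y2 ^+ 2 = x2 ^+ 3 + 1) (d : x2 - x1 != 0).

(** The first point is the sum minus the second point, so its abscissa solves the equation attached
    to the abscissas of those two. *)
Lemma chord_root (X := sec_x x1 y1 x2 y2) :
  chA mul x2 X 1 * x1 ^+ 2 + chB mul x2 X 1 * x1 + chC mul x2 X 1 = 0.
Proof. by rewrite /X /sec_x /slope /chA /chB /chC; field: h1 h2. Qed.

Lemma chA_neq0 : chA mul x2 x1 1 != 0.
Proof. by rewrite /chA mulr1 mulf_neq0. Qed.

(** By Vieta, the roots of the equation attached to [x2] and [x1] are the abscissas of the sum and
    of the difference of the two points. *)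
Lemma chBE : chB mul x2 x1 1 =
  - chA mul x2 x1 1 * (sec_x x1 y1 x2 y2 + sec_x x1 y1 x2 (- y2)).
Proof. by rewrite /sec_x /slope /chA /chB; field: h1 h2. Qed.

Lemma chCE : chC mul x2 x1 1 =
  chA mul x2 x1 1 * (sec_x x1 y1 x2 y2 * sec_x x1 y1 x2 (- y2)).
Proof. by rewrite /sec_x /slope /chA /chC; field: h1 h2. Qed.

End Sum.

Hypothesis five0 : 5%:R = 0 :> K.
Notation G := (ecgroup (char5_two_neq0 five0) (char5_three_neq0 five0)).

Lemma xcoord_aff x y (h : y ^+ 2 = x ^+ 3 + 1) : xcoord (aff h) = x.
Proof. by []. Qed.

Lemma xcoordN (A : G) : xcoord (- A) = xcoord A.
Proof. by case: (ecP A). Qed.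

(** [Z = xcoord A] is a common root of the two quadratics. *)
Lemma elimZ_sum (A R A' R' : G) : A != 0 -> R != 0 -> A' != 0 -> R' != 0 ->
  xcoord A != xcoord R -> xcoord A' = xcoord A + 1 -> xcoord R' = xcoord R + 1 ->
  elimZ mul 1 (xcoord R) (xcoord (A + R)) 1 (xcoord (A' + R')) 1 = 0.
Proof.
case: (ecP A) => [|x1 y1 h1 _]; first by rewrite eqxx.
case: (ecP R) => [|x2 y2 h2 _]; first by rewrite eqxx.
case: (ecP A') => [|x1' y1' h1' _]; first by rewrite eqxx.
case: (ecP R') => [|x2' y2' h2' _]; first by rewrite eqxx.
rewrite !xcoord_aff => x12 e1 e2.
have d : x2 - x1 != 0 by rewrite subr_eq0 eq_sym.
have d' : x2' - x1' != 0 by rewrite e1 e2 opprD addrACA subrr addr0.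
have -> : (aff h1 : G) + (aff h2 : G) = aff (secP h1 h2 d) by exact: add_sec.
have -> : (aff h1' : G) + (aff h2' : G) = aff (secP h1' h2' d') by exact: add_sec.
rewrite !xcoord_aff; have r := chord_root h1 h2 d; have := chord_root h1' h2' d'.
move: (sec_x x1' y1' x2' y2') => z r'.
by apply: (quad_res_common_root r); rewrite -e2 -[RHS]r' e1; ring.
Qed.

(** Both quadratics split, with the abscissas of sum and difference as roots; a zero resultant
    matches one root of each, and [b], [b'] record which. *)
Lemma elimZ_eq0_inv (A R A' R' : G) : A != 0 -> R != 0 -> A' != 0 -> R' != 0 ->
  xcoord A != xcoord R -> xcoord A' != xcoord R' -> xcoord R' = xcoord R + 1 ->
  elimZ mul 1 (xcoord R) (xcoord A) 1 (xcoord A') 1 = 0 ->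
  exists b b' : bool, xcoord (A' + R' *~ (-1) ^+ b') = xcoord (A + R *~ (-1) ^+ b) + 1.
Proof.
case: (ecP A) => [|x1 y1 h1 _]; first by rewrite eqxx.
case: (ecP R) => [|x2 y2 h2 _]; first by rewrite eqxx.
case: (ecP A') => [|x1' y1' h1' _]; first by rewrite eqxx.
case: (ecP R') => [|x2' y2' h2' _]; first by rewrite eqxx.
rewrite !xcoord_aff => x12 x12' e2.
have d : x2 - x1 != 0 by rewrite subr_eq0 eq_sym.
have d' : x2' - x1' != 0 by rewrite subr_eq0 eq_sym.
have sumE (u v : K) (h : v ^+ 2 = u ^+ 3 + 1) (u' v' : K) (h' : v' ^+ 2 = u' ^+ 3 + 1)
    (b : bool) : u' - u != 0 ->
    xcoord ((aff h : G) + (aff h' : G) *~ (-1) ^+ b) = sec_x u v u' ((-1) ^+ b * v').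
  move=> du; case: b; rewrite ?expr1 ?expr0 ?mulrN1z ?mulr1z ?mulN1r ?mul1r.
    have hN : (- v') ^+ 2 = u' ^+ 3 + 1 by rewrite sqrrN.
    have -> : - (aff h' : G) = aff hN by exact: val_inj.
    by have -> : (aff h : G) + (aff hN : G) = aff (secP h hN du) by exact: add_sec.
  by have -> : (aff h : G) + (aff h' : G) = aff (secP h h' du) by exact: add_sec.
rewrite /elimZ -e2 (chBE h1 h2) // (chCE h1 h2) // (chBE h1' h2') // (chCE h1' h2') //.
set a := chA _ x2 _ _; set a' := chA _ x2' _ _.
set z1 := sec_x x1 y1 x2 y2; set z2 := sec_x x1 y1 x2 (- y2).
set z1' := sec_x x1' y1' x2' y2'; set z2' := sec_x x1' y1' x2' (- y2').
rewrite (_ : a' *+ 2 + _ = - a' * ((z1' - 1) + (z2' - 1))); last by ring.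
rewrite (_ : a' + _ + _ = a' * ((z1' - 1) * (z2' - 1))); last by ring.
rewrite quad_res_factor => /eqP; rewrite mulf_eq0 expf_eq0 mulf_eq0.
rewrite (negPf (chA_neq0 d)) (negPf (chA_neq0 d')) /= !mulf_eq0 -!orbA.
have E (b b' : bool) :
    sec_x x1 y1 x2 ((-1) ^+ b * y2) - (sec_x x1' y1' x2' ((-1) ^+ b' * y2') - 1) == 0 ->
    exists b b' : bool, xcoord ((aff h1' : G) + (aff h2' : G) *~ (-1) ^+ b') =
      xcoord ((aff h1 : G) + (aff h2 : G) *~ (-1) ^+ b) + 1.
  rewrite subr_eq0 => /eqP e; exists b, b'; rewrite !sumE // e; ring.
move: (E false false) (E false true) (E true false) (E true true).
rewrite !expr0 !expr1 !mul1r !mulN1r.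
by move=> E1 E2 E3 E4 /or4P [/E1|/E2|/E3|/E4].
Qed.

End Chords.

(** * Multiples of the two points *)

Section Transcendental.
Variables (K : closedFieldType) (ev : {rmorphism {poly 'F_5} -> K}).
Hypothesis ev_inj : injective ev.

Lemma ev_five0 : 5%:R = 0 :> K.
Proof.
by rewrite -(rmorph_nat ev) -polyC_natr (_ : 5%:R = 0 :> 'F_5) ?rmorph0 //; apply/val_inj.
Qed.

Let five0 := ev_five0.
Notation G := (ecgroup (char5_two_neq0 five0) (char5_three_neq0 five0)).
Local Notation F := (ec_frob five0).

Lemma ev_XaddC_exp_inj c : injective (fun k : nat => ev ('X + c%:P) ^+ k).
Proof.
move=> k l; rewrite -!rmorphXn => /ev_inj /(congr1 (fun p : {poly 'F_5} => size p)).
by rewrite -[c]opprK polyCN /= !size_exp_XsubC => -[].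
Qed.

(** Multiplication by [5 ^+ m] is a Frobenius iterate up to a sign, to which the abscissa is
    blind. *)
Lemma xcoord_mulz_pow5 (A : G) m M : injective (fun k => xcoord A ^+ (25 ^ k)) ->
  xcoord (A *~ (5 ^+ m * M)) = xcoord (A *~ M) ^+ (25 ^ m).
Proof.
move=> A_inj; rewrite -xcoord_iter_frob.
have FM : forall l, iter l (F : G -> G) (A *~ M) = iter l (F : G -> G) A *~ M.
  by elim=> [//|l IHl]; rewrite !iterS IHl raddfMz.
rewrite FM iter_frob_mulz // -mulrzA exprNn -signr_odd.
by case: odd; rewrite ?expr1 ?expr0 ?mul1r // mulN1r mulNr mulrNz xcoordN.
Qed.

Section Point.
Variables (c : 'F_5) (s : K) (A : G).
Local Notation w := (ev ('X + c%:P)).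
Hypothesis Aval : val (A : ecurve K) = Some (w, s).

Lemma point_exp_inj : injective (fun k => xcoord A ^+ (25 ^ k)).
Proof.
have -> : xcoord A = w by rewrite /xcoord Aval.
by move=> k l /ev_XaddC_exp_inj /eqP; rewrite eqn_exp2l // => /eqP.
Qed.

Lemma der_point : der ev w 1.
Proof. by have := der_ev ev ('X + c%:P); rewrite derivD derivX derivC addr0 rmorph1. Qed.

(** As 5 acts as [- F], the multiple is, up to sign, [A] plus the Frobenius image of a multiple of
    [A], where [der_xcoord_frob] applies. *)
Lemma der_xcoord_mulz (b : bool) z : exists2 f', der ev (xcoord (A *~ ((-1) ^+ b + 5 * z))) f' &
  f' ^+ 2 * (w ^+ 3 + 1) = xcoord (A *~ ((-1) ^+ b + 5 * z)) ^+ 3 + 1.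
Proof.
have -> : xcoord (A *~ ((-1) ^+ b + 5 * z)) = xcoord (A + (F (A *~ (- (-1) ^+ b * z)) : G)).
  rewrite raddfMz /=.
  have x25 : xcoord A ^+ 25 != xcoord A.
    by apply/negP => /eqP e; have /point_exp_inj : xcoord A ^+ (25 ^ 1) = xcoord A ^+ (25 ^ 0).
  have -> : (F A : G) = - (A *+ 5) by rewrite ec_mul5_frob // opprK.
  rewrite mulrzDr [5 * z]mulrC mulrzA.
  case: b; rewrite ?expr1 ?expr0 ?mulN1r ?opprK ?mul1r ?mulrN1z ?mulr1z.
    rewrite -[RHS]xcoordN opprD; congr (xcoord (_ + _)).
    by rewrite mulNrz opprK -mulrzA mulrC mulrzA.
  congr (xcoord (_ + _)).
  by rewrite mulrNz mulNrz opprK -mulrzA mulrC mulrzA.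
exact (der_xcoord_frob ev_inj der_point Aval (rational_point_mulz ev_inj der_point Aval _)).
Qed.

End Point.

Section TwoPoints.
Variables (s1 s2 : K) (P Q : G).
Local Notation t := (ev 'X).
Hypothesis Pval : val (P : ecurve K) = Some (t + 1, s1).
Hypothesis Qval : val (Q : ecurve K) = Some (t, s2).

Let Pval' : val (P : ecurve K) = Some (ev ('X + 1%:P), s1).
Proof. by rewrite rmorphD rmorph1. Qed.
Let Qval' : val (Q : ecurve K) = Some (ev ('X + 0%:P), s2).
Proof. by rewrite addr0. Qed.

Let P_inj := point_exp_inj Pval'.
Let Q_inj := point_exp_inj Qval'.

(** [f] and [f + 1] have the same derivative, which is eliminated between their differential
    equations over [t] and [t + 1]. *)
Lemma xcoord_cubic (b b' : bool) z z' (f := xcoord (Q *~ ((-1) ^+ b + 5 * z))) :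
  xcoord (P *~ ((-1) ^+ b' + 5 * z')) = f + 1 ->
  (f ^+ 3 + 1) * ((t + 1) ^+ 3 + 1) = ((f + 1) ^+ 3 + 1) * (t ^+ 3 + 1).
Proof.
move=> e; have [f' df f'E] := der_xcoord_mulz Qval' b z.
have [h' dh h'E] := der_xcoord_mulz Pval' b' z'.
rewrite e in dh h'E; rewrite -/f in df f'E.
have fh : f' = h' by have := der_uniq ev_inj dh (derD df (der1 ev)); rewrite addr0 => ->.
have ew0 : ev ('X + 0%:P) = t by rewrite addr0.
have ew1 : ev ('X + 1%:P) = t + 1 by rewrite rmorphD rmorph1.
by rewrite ew0 in f'E; rewrite ew1 -fh in h'E; rewrite -f'E -h'E; ring.
Qed.

Lemma eventually_notin (g : nat -> K) (r : seq K) : injective g ->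
  exists M, forall m, (M <= m)%N -> g m \notin r.
Proof.
move=> g_inj; elim: r => [|x r [M HM]]; first by exists 0%N.
have [[m gm]|gx] := EM (exists m, g m = x).
  exists (maxn M m.+1) => l; rewrite geq_max inE negb_or => /andP[/HM -> ml].
  by rewrite andbT -gm (inj_eq g_inj) gtn_eqF.
by exists M => m /HM; rewrite inE negb_or => ->; rewrite andbT; apply/eqP => e; apply: gx; exists m.
Qed.

(* The cubic in [f] does not vanish identically since its value at [-1] is
   [- (t ^+ 3 + 1)]. *)
Lemma cubic_bound : exists M, forall m : nat, (M <= m)%N -> forall f, f = xcoord (Q *~ m%:Z) ->
  (f ^+ 3 + 1) * ((t + 1) ^+ 3 + 1) <> ((f + 1) ^+ 3 + 1) * (t ^+ 3 + 1).
Proof.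
pose C : {poly K} := ('X ^+ 3 + 1) * ((t + 1) ^+ 3 + 1)%:P - (('X + 1) ^+ 3 + 1) * (t ^+ 3 + 1)%:P.
have CE f : C.[f] = (f ^+ 3 + 1) * ((t + 1) ^+ 3 + 1) - ((f + 1) ^+ 3 + 1) * (t ^+ 3 + 1).
  by rewrite /C !(hornerD, hornerN, hornerM, horner_exp, hornerX, hornerC).
have C0 : C != 0.
  apply/eqP => C0; have : - (t ^+ 3 + 1) = C.[-1] by rewrite CE; ring.
  move=> /eqP; rewrite C0 horner0.
  rewrite oppr_eq0 addr_eq0 => /eqP t3.
  (* [t ^+ 3 = - 1] would give [t ^+ 6 = t ^+ 0]. *)
  suff : 6%N = 0%N by [].
  apply: (@ev_XaddC_exp_inj 0); rewrite /= addr0 (exprM _ 3 2) t3; ring.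
have [r Cr] := closed_field_poly_normal C.
(* Positive multipliers rule out the alternative [m = - n]. *)
have g_inj : injective (fun m : nat => xcoord (Q *~ m.+1%:Z)).
  by move=> m n e; have [||e'|e'] := xcoord_mulz_inj Q_inj _ _ e; lia.
have [M HM] := eventually_notin r g_inj.
exists M.+1 => -[//|m] mM f fE fC.
have := HM m mM; rewrite -fE -root_prod_XsubC /root.
have : C.[f] == 0 by rewrite CE fC subrr.
rewrite Cr hornerZ mulf_eq0 lead_coef_eq0 (negPf C0) /=.
by move=> ->.
Qed.

(** The factor [5 ^+ m] raises both abscissas to the power [25 ^ m]; this map is additive, injective
    and fixes 1, so the case [m = 0] suffices, where [xcoord_cubic] contradicts [cubic_bound]. *)
Lemma no_shift : exists N, forall m M z z' (b b' : bool),
  N%:Z <= M -> M = (-1) ^+ b + 5 * z ->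
  xcoord (P *~ (5 ^+ m * ((-1) ^+ b' + 5 * z'))) <> xcoord (Q *~ (5 ^+ m * M)) + 1.
Proof.
have [N HN] := cubic_bound; exists N => m M z z' b b' NM ME.
rewrite !xcoord_mulz_pow5 // => e.
have {}e : xcoord (P *~ ((-1) ^+ b' + 5 * z')) = xcoord (Q *~ M) + 1.
  have frE x : iter m (frob25 five0) x = x ^+ (25 ^ m).
    elim: m {e} => [|m IHm]; first by rewrite expr1.
    by rewrite iterS IHm frob25E -exprM expnSr.
  have fr1 x y : iter m (frob25 five0) (x + y) = iter m (frob25 five0) x + iter m (frob25 five0) y.
    by elim: m {e frE} => [//|m IHm]; rewrite !iterS IHm rmorphD.
  have fr_inj : injective (fun x => iter m (frob25 five0) x).
    by elim: m {e frE fr1} => [//|m IHm] x y; rewrite !iterS => /fmorph_inj; exact: IHm.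
  by apply: fr_inj; rewrite fr1 !frE e expr1n.
have M0 : M = `|M|%N%:Z by lia.
apply: (HN `|M|%N _ (xcoord (Q *~ M))); first by lia.
  by rewrite -M0.
by rewrite ME; apply: xcoord_cubic; rewrite -ME; exact: e.
Qed.

Variables (u v : Gm K).
Hypotheses (u_def : gm_val u = t + 1) (v_def : gm_val v = t).

Lemma val_xcoord (R : G) : R != 0 -> exists y, val (R : ecurve K) = Some (xcoord R, y).
Proof. by case: (ecP R) => [|x y h _]; [rewrite eqxx | exists y]. Qed.

Lemma t_add1_exp25 i : (t + 1) ^+ (25 ^ i) = t ^+ (25 ^ i) + 1.
Proof.
elim: i => [//|i IHi]; rewrite !expnSr !exprM IHi.
by rewrite -!(frob25E five0) rmorphD rmorph1.
Qed.

Let xP : xcoord P = t + 1. Proof. by rewrite /xcoord Pval. Qed.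
Let xQ : xcoord Q = t. Proof. by rewrite /xcoord Qval. Qed.

Lemma qelim_norm_mulrn i k n : n = (25 ^ i + 25 ^ k)%N ->
  qelim_norm (u *+ n, v *+ n, (P : ecurve K) *+ n, (Q : ecurve K) *+ n) =
    elimZ *%R 1 (t ^+ (25 ^ i)) (xcoord (Q *+ n)) 1 (xcoord (P *+ n)) 1 *
    elimZ *%R 1 (t ^+ (25 ^ k)) (xcoord (Q *+ n)) 1 (xcoord (P *+ n)) 1.
Proof.
move=> nE; have n0 : n%:Z != 0 by rewrite nE eqz_nat addn_eq0 !expn_eq0.
have [yP PE] := val_xcoord (mulz_neq0 P_inj n0).
have [yQ QE] := val_xcoord (mulz_neq0 Q_inj n0).
apply: (qelim_normE _ _ PE QE).
  by rewrite !gm_valMn u_def v_def nE !exprD !t_add1_exp25; ring.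
by rewrite gm_valMn v_def nE exprD.
Qed.

Lemma qelim_norm_diag j : (0 < j)%N -> let n := (25 ^ (2 * j) + 25 ^ j)%N in
  qelim_norm (u *+ n, v *+ n, (P : ecurve K) *+ n, (Q : ecurve K) *+ n) = 0.
Proof.
move=> j0 n; rewrite (@qelim_norm_mulrn (2 * j) j) // !mulrn_frob2 // -[j.*2]mul2n.
have it0 (R : G) m : injective (fun k => xcoord R ^+ (25 ^ k)) -> iter m (F : G -> G) R != 0.
  by move=> R_inj; rewrite iter_frob_mulz // mulz_neq0 // expf_neq0.
(* The summand [F^(2 j) Q] of [n Q] lies over the root [t ^+ (25 ^ (2 * j))] and [F^(2 j) P] over
   that root plus 1; the summands [F^(4 j) Q] and [F^(4 j) P] give the common [Z]. *)
have := @elimZ_sum _ five0 (iter (2 * j).*2 (F : G -> G) Q) (iter (2 * j) (F : G -> G) Q)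
   (iter (2 * j).*2 (F : G -> G) P) (iter (2 * j) (F : G -> G) P).
rewrite !it0 // !xcoord_iter_frob xP xQ !t_add1_exp25 => -> //; first by rewrite mul0r.
by rewrite -xQ (inj_eq Q_inj) -mul2n; lia.
Qed.

Lemma qelim_norm_neq0 j : (0 < j)%N -> exists N, forall i, (N <= i)%N ->
  let n := (25 ^ i + 25 ^ j)%N in
  qelim_norm (u *+ n, v *+ n, (P : ecurve K) *+ n, (Q : ecurve K) *+ n) <> 0.
Proof.
move=> j0; have [N HN] := no_shift.
have pow5_gt m : (m < 5 ^ m)%N by exact: ltn_expl.
have pow5 m : (5 ^ m)%N%:Z = 5 ^+ m by rewrite -natz natrX.
exists (2 * j + N).+1 => i Ni n; rewrite (@qelim_norm_mulrn i j) // => /eqP.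
have nE : n%:Z = 5 ^+ (2 * i) + 5 ^+ (2 * j) by rewrite /n PoszD -!pow5 !(expnM 5 2).
(* A zero factor at the root [t ^+ (25 ^ k)] makes the abscissas of [(n ± 5 ^ k) P] and
   [(n ± 5 ^ k) Q] differ by 1, with independent signs. *)
have key k : (k == i) || (k == j) ->
    elimZ *%R 1 (t ^+ (25 ^ k)) (xcoord (Q *+ n)) 1 (xcoord (P *+ n)) 1 = 0 -> False.
  move=> kij.
  (* This keeps [n Q] and [n P] distinct from [± F^k Q] and [± F^k P], so that the chord formulas
     apply. *)
  have n_gt : (5 ^ k < n)%N.
    have H m : (0 < 5 ^ m <= 25 ^ m)%N.
      by rewrite expn_gt0 /=; case: m => // m; rewrite leq_exp2r.
    have := H i; have := H j; rewrite /n; case/orP: kij => /eqP ->; lia.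
  have n0 : n%:Z != 0 by lia.
  have ne (R : G) : injective (fun k => xcoord R ^+ (25 ^ k)) ->
      xcoord (R *+ n) != xcoord (iter k (F : G -> G) R).
    move=> R_inj; apply/eqP; rewrite iter_frob_mulz // pmulrn.
    have k5 : (`|(- 5) ^+ k| = 5 ^ k)%N by rewrite abszX.
    move=> /(xcoord_mulz_inj R_inj) []; [by lia | by rewrite expf_neq0 | lia | lia].
  have it0 (R : G) : injective (fun k => xcoord R ^+ (25 ^ k)) -> iter k (F : G -> G) R != 0.
    by move=> R_inj; rewrite iter_frob_mulz // mulz_neq0 // expf_neq0.
  have := @elimZ_eq0_inv _ five0 (Q *+ n) (iter k (F : G -> G) Q) (P *+ n) (iter k (F : G -> G) P)
    (mulz_neq0 Q_inj n0) (it0 _ Q_inj) (mulz_neq0 P_inj n0) (it0 _ P_inj) (ne _ Q_inj) (ne _ P_inj).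
  rewrite !xcoord_iter_frob xP xQ t_add1_exp25 => /(_ erefl) H /H {H} [b [b' e]].
  move: e; rewrite !iter_frob_mulz // -!mulrzA !pmulrn -!mulrzDr.
  have sgn (b0 : bool) : (- 5) ^+ k * (-1) ^+ b0 = (-1) ^+ (odd k (+) b0) * 5 ^+ k :> int.
    by rewrite exprNn -signr_odd -mulrA [5 ^+ k * _]mulrC mulrA -signr_addb.
  rewrite !sgn; move: (odd k (+) b) (odd k (+) b') => {b b'} b b'.
  pose l := (i - (2 * j).+1)%N; have iE : i = (2 * j + 1 + l)%N by rewrite /l; lia.
  have Nl : (N <= l)%N by rewrite /l; lia.
  rewrite nE; case/orP: kij => /eqP ->.
    (* Since [i > 2 j], the 5-part of [n ± 5 ^ i] is [5 ^ (2 j)] and the cofactor is 1 modulo 5. *)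
    have E (c : bool) : 5 ^+ (2 * i) + 5 ^+ (2 * j) + (-1) ^+ c * 5 ^+ i =
       5 ^+ (2 * j) * ((-1) ^+ false + 5 * (5 ^+ (2 * j + 1 + 2 * l) + (-1) ^+ c * 5 ^+ l)) :> int.
      rewrite iE (_ : 2 * (2 * j + 1 + l) = 2 * j + 1 + (2 * j + 1 + 2 * l))%N; last by lia.
      by rewrite !(exprD _ (2 * j + 1)) !(exprD _ (2 * j) 1); ring.
    rewrite !E; apply: HN; last by [].
    rewrite (_ : (2 * j + 1 + 2 * l = (2 * j + l) + 1 + l)%N); last by lia.
    rewrite !(exprD _ _ l) exprD expr1 -!pow5; have := pow5_gt l.
    have : (5 ^ l <= 5 ^ (2 * j + l) * 5 ^ l)%N by rewrite leq_pmull // expn_gt0.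
    move: (5 ^ (2 * j + l))%N (5 ^ l)%N => p q; rewrite -mulrA [5 * q%:Z]mulrC mulrA -PoszM.
    by case: b; rewrite ?expr0 ?expr1; lia.
  (* Since [j > 0], the 5-part of [n ± 5 ^ j] is [5 ^ j] and the cofactor is [± 1] modulo 5. *)
  have E (c : bool) : 5 ^+ (2 * i) + 5 ^+ (2 * j) + (-1) ^+ c * 5 ^+ j =
      5 ^+ j * ((-1) ^+ c + 5 * (5 ^+ (3 * j + 1 + 2 * l) + 5 ^+ j.-1)) :> int.
    rewrite iE (_ : 2 * (2 * j + 1 + l) = j + 1 + (3 * j + 1 + 2 * l))%N; last by lia.
    rewrite (_ : 2 * j = j + 1 + j.-1)%N; last by lia.
    by rewrite !(exprD _ (j + 1)) !(exprD _ j 1); ring.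
  rewrite !E; apply: HN; last by [].
  rewrite -!pow5; have := pow5_gt (3 * j + 1 + 2 * l)%N.
  by case: b; rewrite ?expr0 ?expr1; lia.
by rewrite mulf_eq0 => /orP [] /eqP; apply: key; rewrite eqxx ?orbT.
Qed.

End TwoPoints.
End Transcendental.

(** * Exponents solving the equation of V0 *)

(* The powers of ['X] modulo [P] take finitely many values, so at a root [t] of [P]
   two powers of [t] would coincide. *)
Lemma horner_map_finite_neq0 (F : finFieldType) (K : fieldType) (f : {rmorphism F -> K})
    (t : K) (P : {poly F}) :
  injective (fun k : nat => t ^+ k) -> P != 0 -> (map_poly f P).[t] != 0.
Proof.
move=> t_inj P0; apply/eqP => Pt.
pose r k : {ffun 'I_(size P) -> F} := [ffun i : 'I_(size P) => ('X^k %% P)`_i].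
pose N := #|{ffun 'I_(size P) -> F}|.
suff /leq_card : injective (fun k : 'I_N.+1 => r k) by rewrite card_ord ltnn.
move=> k l /ffunP e; apply/val_inj/t_inj => /=.
have {}e : 'X^k %% P = 'X^l %% P.
  apply/polyP => i; have [iP|iP] := ltnP i (size P).
    by have := e (Ordinal iP); rewrite !ffunE.
  by rewrite !nth_default // (leq_trans _ iP) // ltnW // ltn_modp.
have E m : t ^+ m = (map_poly f ('X^m %% P)).[t].
  have := congr1 (fun p => (map_poly f p).[t]) (divp_eq 'X^m P).
  by rewrite /= rmorphD rmorphM map_polyXn hornerD hornerM Pt mulr0 add0r hornerXn.
by rewrite !E e.
Qed.

Lemma coef_XaddC_exp (R : comNzRingType) (c : R) n k :
  (('X + c%:P) ^+ n)`_k = c ^+ (n - k) *+ 'C(n, k).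
Proof.
rewrite addrC exprDn coef_sum.
have [kn|kn] := ltnP k n.+1.
  rewrite (bigD1 (Ordinal kn)) //= coefMn -rmorphXn coefCM coefXn eqxx mulr1 big1 ?addr0 //.
  move=> i ik; rewrite coefMn -rmorphXn coefCM coefXn.
  by rewrite eq_sym -(inj_eq val_inj) in ik; rewrite (negPf ik) mulr0 mul0rn.
rewrite bin_small // mulr0n big1 // => i _.
rewrite coefMn -rmorphXn coefCM coefXn (_ : k == i = false) ?mulr0 ?mul0rn //.
by rewrite gtn_eqF // (leq_trans (ltn_ord i)).
Qed.

Section Char5.
Variable F : fieldType.
Hypothesis char5 : 5%N \in [pchar F]%R.

Lemma XaddC_exp5 (c : F) k :
  ('X + c%:P) ^+ (5 ^ k) = ('X + (c ^+ (5 ^ k))%:P) \Po 'X^(5 ^ k).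
Proof.
have c5 : 5%N \in [pchar {poly F}] by rewrite pchar_poly.
rewrite exprDn_pchar ?pnatX ?pnatE ?c5 //.
by rewrite comp_polyD comp_polyX comp_polyC rmorphXn.
Qed.

Let dvd5 n : (n%:R == 0 :> F) = (5 %| n)%N.
Proof. by rewrite -(dvdn_pcharf char5). Qed.

Let two0 : 2 != 0 :> F.
Proof. by rewrite dvd5. Qed.

(** With [Q = 5 ^ s] the power is [(X + c) (X^Q + c^Q)^m]. At this exponent only the summand [c] of
    the first factor contributes, because [Q (m - 1) - 1] is not a multiple of [Q]. *)
Lemma coef_XaddC_exp_1D (c : F) s m : (0 < s)%N -> (1 < m)%N ->
  (('X + c%:P) ^+ (1 + 5 ^ s * m))`_(5 ^ s * m.-1) = c ^+ (5 ^ s).+1 *+ m.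
Proof.
move=> s0 m1; rewrite exprD exprM XaddC_exp5 -rmorphXn /= expr1 mulrDl coefD mul_polyC.
have Q1 : (1 < 5 ^ s)%N by rewrite -{1}(expn0 5) ltn_exp2l.
have Q0 : (0 < 5 ^ s)%N by exact: ltnW.
rewrite coefZ coef_comp_poly_Xn // dvdn_mulr // mulKn // coef_XaddC_exp.
rewrite mulrC coefMX coef_comp_poly_Xn //.
have -> : (5 ^ s * m.-1 == 0)%N = false by rewrite muln_eq0 expn_eq0 /=; lia.
have -> : (5 ^ s %| (5 ^ s * m.-1).-1)%N = false.
  apply/negP => d; have : (5 ^ s %| 5 ^ s * m.-1)%N by exact: dvdn_mulr.
  rewrite -[X in (_ %| X)%N]prednK ?muln_gt0 ?Q0 /= -?subn1 ?subn_gt0 //.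
  rewrite -[X in (_ %| X)%N]addn1 dvdn_addr ?subn1 // dvdn1 => /eqP Q.
  by rewrite Q in Q1.
rewrite add0r; have -> : (m - m.-1 = 1)%N by lia.
by rewrite expr1 mulrnAr -exprS; case: m m1 => //= m _; rewrite binSn.
Qed.

(* For [n > 2] the coefficient of ['X^(n - 2)] gives [n = 1 + 5 ^ s * m] with
   [5] not dividing [m], and that of ['X^(5 ^ s * m.-1)] gives [m = 1]. *)
Lemma two_term_exponent_coprime (b c : F) n : ~~ (5 %| n)%N -> b != 0 -> c != 0 ->
  ('X + b%:P) ^+ n + ('X + (- b)%:P) ^+ n = 'X^n *+ 2 + c%:P ->
  exists s, n = (1 + 5 ^ s)%N.
Proof.
move=> n5 b0 c0 e.
have n0 : (0 < n)%N by case: n n5 {e}.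
have ce k : (0 < k < n)%N -> (('X + b%:P) ^+ n)`_k + (('X + (- b)%:P) ^+ n)`_k = 0.
  move=> /andP [k0 kn]; rewrite -coefD e coefD coefMn coefXn coefC.
  by rewrite ltn_eqF // gtn_eqF // mul0rn addr0.
have [n1|n2|n2] := ltngtP n 2; last by exists 0%N.
  have {n1 n0}n1 : n = 1%N by lia.
  move: e; rewrite n1 !expr1 => /(congr1 (fun p : {poly F} => p`_0)).
  rewrite !coefD !coefX !coefC /= !add0r subrr => /esym/eqP.
  by rewrite (negPf c0).
have n1_5 : (5 %| n.-1)%N.
  have := ce (n - 2)%N; rewrite !coef_XaddC_exp (_ : n - (n - 2) = 2)%N; last by lia.
  rewrite sqrrN -mulr2n -mulrnA => /(_ ltac:(lia)) /eqP.
  rewrite -mulr_natr mulf_eq0 expf_eq0 (negPf b0) andbF /= dvd5 bin_sub; last by lia.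
  rewrite mulnC -mul_bin_diag bin1.
  by rewrite Euclid_dvdM // (negPf n5).
have n1_gt0 : (0 < n.-1)%N by lia.
have [m m5 nE] := pfactor_coprime (isT : prime 5) n1_gt0.
have s0 : (0 < logn 5 n.-1)%N by rewrite logn_gt0 mem_primes n1_gt0 n1_5.
have {}nE : n = (1 + 5 ^ logn 5 n.-1 * m)%N by rewrite mulnC -nE; lia.
exists (logn 5 n.-1); move: (logn 5 n.-1) s0 nE => s s0 nE.
have [m1|m1|m1] := ltngtP m 1; last by rewrite {1}nE m1 muln1.
  by move: m1 m5; case: m nE.
have Q0 : (0 < 5 ^ s)%N by rewrite expn_gt0.
have := ce (5 ^ s * m.-1)%N; rewrite nE !coef_XaddC_exp_1D //.
rewrite -mulrnDl (_ : (- b) ^+ (5 ^ s).+1 = b ^+ (5 ^ s).+1); last first.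
  by rewrite exprNn -signr_odd /= oddX orbT /= expr0 mul1r.
rewrite -mulr2n -mulrnA => /(_ ltac:(nia)) /eqP.
rewrite -mulr_natr mulf_eq0 expf_eq0 (negPf b0) andbF /= dvd5 Euclid_dvdM //.
by case/orP => // m5'; rewrite prime_coprime // m5' in m5.
Qed.

(** The 5-part [5 ^ k] of [n] splits off: both sides are polynomials in [X^(5 ^ k)], which leaves an
    exponent prime to 5. *)
Lemma two_term_exponent (a c : F) n : a != 0 -> c != 0 ->
  ('X + a%:P) ^+ n + ('X - a%:P) ^+ n = 'X^n *+ 2 + c%:P ->
  exists i j, n = (5 ^ i + 5 ^ j)%N.
Proof.
move=> a0 c0; case: (posnP n) => [->|n0].
  rewrite !expr0 -[1 *+ 2]/(1 + 1) -[LHS]addr0 => /addrI/esym/eqP.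
  by rewrite polyC_eq0 (negPf c0).
have [m m5 ->] := pfactor_coprime (isT : prime 5) n0.
move: (logn 5 n) => k; rewrite mulnC -rmorphN !exprM !XaddC_exp5.
have -> : 'X^(5 ^ k) ^+ m *+ 2 + c%:P = ('X^m *+ 2 + c%:P) \Po 'X^(5 ^ k).
  by rewrite comp_polyD comp_polyC rmorphMn rmorphXn /= comp_polyX.
rewrite -!rmorphXn -rmorphD /= => e.
have {}e : ('X + (a ^+ (5 ^ k))%:P) ^+ m + ('X + (- a ^+ (5 ^ k))%:P) ^+ m = 'X^m *+ 2 + c%:P.
  apply/polyP => i; have := congr1 (fun p : {poly F} => p`_(5 ^ k * i)) e.
  rewrite /= !coef_comp_poly_Xn ?expn_gt0 // dvdn_mulr // mulKn ?expn_gt0 //.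
  by rewrite [(- a) ^+ _]exprNn -signr_odd oddX orbT expr1 mulN1r.
have [||s ->] := two_term_exponent_coprime _ _ c0 e.
- by rewrite -prime_coprime.
- by rewrite expf_neq0.
by exists k, (k + s)%N; rewrite expnD mulnDr muln1.
Qed.

End Char5.

(** Powers of 5 are 1 or 5 modulo 24 according to parity, and only [1 + 1] gives 2. *)
Lemma exp5_sum_mod24 i j : 5 ^ i + 5 ^ j = 2 %[mod 24] ->
  exists i' j', (5 ^ i + 5 ^ j = 25 ^ i' + 25 ^ j')%N.
Proof.
have E k : 5 ^ k = (if odd k then 5 else 1) %[mod 24].
  rewrite -{1}(odd_double_half k) expnD -mul2n expnM.
  by rewrite -modnMmr -modnXm exp1n; case: odd.
rewrite -modnDm !E modnDm => H; exists i./2, j./2.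
have [oi oj] : ~~ odd i /\ ~~ odd j by move: H; case: odd; case: odd.
by rewrite -!(expnM 5 2) !mul2n !even_halfK.
Qed.

Section V0.
Variables (K : fieldType) (F25 : finFieldType) (F25_card : #|F25| = (5 ^ 2)%N).
Variables (j : {rmorphism F25 -> K}) (a : {unit F25}).
Hypothesis a_gen : generator [set: {unit F25}]%SET a.
Variable t : K.
Hypothesis t_inj : injective (fun k : nat => t ^+ k).

Lemma F25_pchar : 5%N \in [pchar F25]%R.
Proof. exact: card_finPcharP F25_card _. Qed.

Let alpha := j (val a).

Lemma order_a : #[a]%g = 24%N.
Proof. by rewrite /order -(eqP a_gen) card_finField_unit F25_card. Qed.

Lemma a_neq0 : val a != 0.
Proof. by rewrite -unitfE; exact: (valP a). Qed.

Lemma alpha_exp25 k : alpha ^+ (25 ^ k) = alpha.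
Proof.
elim: k => [|k IHk]; first exact: expr1.
by rewrite expnSr exprM IHk /alpha -rmorphXn -[25%N]/(5 ^ 2)%N -F25_card expf_card.
Qed.

Lemma V0_exponent n :
  (t + alpha) ^+ n + (t - alpha) ^+ n = 2 * t ^+ n + 2 * alpha ^+ 2 <->
  exists i k, n = (25 ^ i + 25 ^ k)%N.
Proof.
have cF := F25_pchar; split=> [e|[i [k ->]]]; last first.
  have cK : 5%N \in [pchar K] by rewrite (fmorph_pchar j).
  have E (x : K) m : (t + x) ^+ (25 ^ m) = t ^+ (25 ^ m) + x ^+ (25 ^ m).
    by rewrite exprDn_pchar // -[25%N]/(5 ^ 2)%N -expnM pnatX pnatE // cK.
  have N m : (- alpha) ^+ (25 ^ m) = - alpha.
    by rewrite exprNn alpha_exp25 -signr_odd oddX orbT mulN1r.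
  by rewrite !exprD !E !N !alpha_exp25; ring.
have two0 : 2 != 0 :> F25 by rewrite -(dvdn_pcharf cF).
pose b := val a; have b0 : b != 0 := a_neq0.
(* Transcendence of [t] turns the equation at [t] into a polynomial identity. *)
have eP : ('X + b%:P) ^+ n + ('X - b%:P) ^+ n = 'X^n *+ 2 + (2 * b ^+ 2)%:P.
  apply/eqP; rewrite -subr_eq0; apply: contraTT isT => P0.
  have := horner_map_finite_neq0 j t_inj P0.
  have E2 : j (2 * b ^+ 2) = 2 * alpha ^+ 2 by rewrite rmorphM rmorphXn rmorph_nat.
  rewrite !(rmorphB, rmorphD, rmorphXn, rmorphN) /= !map_polyX !map_polyC /= E2.
  rewrite !(hornerD, hornerN, horner_exp, hornerX, hornerC) -/alpha e.
  rewrite (_ : _ - _ = 0) ?eqxx //.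
  by ring.
have c0 : 2 * b ^+ 2 != 0 by rewrite mulf_neq0 // expf_neq0.
have [i [k nE]] := two_term_exponent cF b0 c0 eP.
have n_gt0 : (0 < n)%N by rewrite nE addn_gt0 expn_gt0.
have n_even : ~~ odd n by rewrite nE oddD !oddX !orbT.
(* Constant terms are compared; [n] is even as a sum of two odd numbers. *)
have : b ^+ n = b ^+ 2.
  have := congr1 (fun p => p.[0]) eP.
  rewrite !(hornerD, hornerN, horner_exp, hornerX, hornerC) !add0r expr0n gtn_eqF // !add0r.
  rewrite exprNn -signr_odd (negPf n_even) expr0 mul1r -mulr2n -[X in X = _]mulr_natl.
  exact: (mulfI two0).
rewrite /b -!FinRing.val_unitX => /val_inj/eqP; rewrite eq_expg_mod_order order_a nE.
by move=> /eqP; exact: exp5_sum_mod24.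
Qed.
End V0.

(** * p-normal sets *)

Local Open Scope classical_set_scope.

(** Pigeonhole: [d] values cannot meet all of [d.+1] disjoint intervals. *)
Lemma exists_avoided_bin d w lo (m : 'I_d -> nat) :
  exists b : 'I_d.+1, forall k, ~~ (lo + b * w <= m k < lo + b * w + w)%N.
Proof.
suff /existsP [b /forallP Hb] :
  [exists b : 'I_d.+1, [forall k, ~~ (lo + b * w <= m k < lo + b * w + w)%N]] by exists b.
apply/contraT => /existsPn H.
have {}H (b : 'I_d.+1) : exists k, (lo + b * w <= m k < lo + b * w + w)%N.
  have := H b; rewrite negb_forall => /existsP [k]; rewrite negbK => Hk; by exists k.
pose f b := xchoose (H b); have fP b := xchooseP (H b).
suff /leq_card : injective f by rewrite !card_ord ltnn.
move=> b b' e; apply/val_inj; have := fP b; have := fP b'; rewrite -/(f b) -/(f b') e /=.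
move=> /andP [h1 h2] /andP [h3 h4]; case: (ltngtP b b') => // bb.
  have : (b * w + w <= b' * w)%N by rewrite -mulSnr leq_mul2r bb orbT.
  lia.
have : (b' * w + w <= b * w)%N by rewrite -mulSnr leq_mul2r bb orbT.
lia.
Qed.

Section ExpSum.
Variables (e d : nat) (c0 : int) (c : 'I_d -> int).
Hypothesis e_gt0 : (0 < e)%N.
Let q : int := (5 ^ e)%N%:Z.

(** The denominator [q - 1] is cleared so that divisibility by powers of 5 can be used. *)
Definition exp_sum_eqn (z : int) (n : 'I_d -> nat) :=
  (q - 1) * z = c0 + \sum_(i < d) c i * q ^+ n i.

Lemma exp_sum_eqnP z n : exp_sum_eqn z n <->
  z%:Q = c0%:Q / (q - 1)%:Q + \sum_(i < d) (c i)%:Q / (q - 1)%:Q * q%:Q ^+ n i.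
Proof.
have q1 : (q - 1)%:Q != 0.
  rewrite intr_eq0 subr_eq0 /q eqz_nat -[X in _ != X]/(5 ^ 0)%N eqn_exp2l //.
  by rewrite -lt0n.
rewrite /exp_sum_eqn; set q1' := q - 1 in q1 *.
have -> : c0%:Q / q1'%:Q + \sum_(i < d) (c i)%:Q / q1'%:Q * q%:Q ^+ n i =
    (c0 + \sum_(i < d) c i * q ^+ n i)%:Q / q1'%:Q.
  clearbody q1'; rewrite intrD mulrDl rmorph_sum mulr_suml; congr (_ + _).
  by apply: eq_bigr => i _; rewrite rmorphM rmorphXn mulrAC.
split => [<-|/eqP]; first by rewrite rmorphM mulrAC mulfV ?mul1r.
by rewrite -(inj_eq (mulIf q1)) mulfVK // -rmorphM eqr_int mulrC => /eqP.
Qed.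

(* Read in base 5, [(q - 1) * (25 ^ (2 * j) + 25 ^ j)] has two blocks of nonzero
   digits, at distance [2 * j]. When [j] is large, some long interval between
   them contains no exponent [e * n k], so the terms above that interval sum to
   the upper block, which can then be moved up independently of the lower one. *)
Lemma exp_sum_shift : exists J, forall j n, (J <= j)%N ->
  exp_sum_eqn ((25 ^ (2 * j))%N%:Z + (25 ^ j)%N%:Z) n -> forall l,
  exists n', exp_sum_eqn ((25 ^ (2 * j + e * l))%N%:Z + (25 ^ j)%N%:Z) n'.
Proof.
(* [C] bounds the sum of all coefficients and [C < 5 ^ C], so no carry crosses a gap of length [C].
   For [j >= d.+1 * C], all [d.+1] candidate gaps starting at [2 * j] end below [4 * j]. *)
pose C := (`|q - 1| + `|c0| + \sum_(i < d) `|c i|)%N.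
exists (d.+1 * C)%N => j n Jj E l.
have [b Hb] := exists_avoided_bin C (2 * j) (fun k => e * n k)%N.
set lo := (2 * j + b * C)%N in Hb; pose hi := (lo + C)%N.
have hi_le : (hi <= 4 * j)%N.
  have : (b.+1 * C <= d.+1 * C)%N by rewrite leq_mul2r ltn_ord orbT.
  rewrite mulSn /hi /lo; lia.
pose low k := (e * n k < lo)%N.
have highP k : ~~ low k -> (hi <= e * n k)%N.
  by move=> lk; have := Hb k; rewrite -leqNgt in lk; rewrite lk -leqNgt.
pose SL := c0 + \sum_(k < d | low k) c k * q ^+ n k.
pose SH := \sum_(k < d | ~~ low k) c k * q ^+ n k.
have qn k : q ^+ n k = (5 ^ (e * n k))%N%:Z by rewrite /q expnM -natz -natz !natrX.
pose X := (q - 1) * (5 ^ (2 * j))%N%:Z - SL.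
have p4 : (25 ^ (2 * j) = 5 ^ (4 * j))%N by rewrite -(expnM 5 2) mulnA.
have p2 : (25 ^ j = 5 ^ (2 * j))%N by rewrite -(expnM 5 2).
have {}E : (q - 1) * ((5 ^ (4 * j))%N%:Z + (5 ^ (2 * j))%N%:Z) = SL + SH.
  by rewrite -p4 -p2 E /SL /SH (bigID low) addrA.
have XE : X = SH - (q - 1) * (5 ^ (4 * j))%N%:Z.
  rewrite /X; move: E; rewrite mulrDr; lia.
(* The defect [X] of the lower block is divisible by [5 ^ hi], as seen from the upper block, but is
   smaller than that in absolute value. *)
have X0 : X = 0.
  have dvdX : ((5 ^ hi)%N%:Z %| X)%Z.
    rewrite XE; apply: rpredB; last first.
      by apply: dvdz_mull; rewrite dvdzE /= dvdn_exp2l.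
    apply: rpred_sum => k lk; apply: dvdz_mull.
    by rewrite qn dvdzE /= dvdn_exp2l // highP.
  have ltX : `|X| < (5 ^ hi)%N%:Z.
    have leX : `|X| <= C%:Z * (5 ^ lo)%N%:Z.
      have p_lo : 1 <= (5 ^ lo)%N%:Z :> int by rewrite lez_nat expn_gt0.
      apply: le_trans (ler_normB _ _) _.
      rewrite /C !PoszD !abszE [leRHS]mulrDl [X in _ <= X + _]mulrDl -addrA.
      apply: lerD.
        rewrite normrM ler_wpM2l //= ger0_norm // lez_nat leq_exp2l // /lo; lia.
      apply: le_trans (ler_normD _ _) _; apply: lerD; first by rewrite ler_peMr.
      apply: le_trans (ler_norm_sum _ _ _) _.
      apply: (@le_trans _ _ (\sum_(k < d | low k) `|c k| * (5 ^ lo)%N%:Z)).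
        apply: ler_sum => k lk; rewrite normrM ler_wpM2l // qn ger0_norm // lez_nat.
        by rewrite leq_exp2l // ltnW.
      rewrite (big_morph Posz PoszD (erefl _)) mulr_suml [leRHS](bigID low) /=.
      rewrite -[leLHS]addr0 lerD //.
      by apply: sumr_ge0 => k _; rewrite mulr_ge0.
    apply: le_lt_trans leX _; rewrite /hi expnD mulnC PoszM ltr_pM2r ?ltz_nat ?expn_gt0 //.
    exact: ltn_expl.
  apply/eqP; apply: contraTT dvdX => Xn0.
  rewrite dvdzE /=; apply/negP => /dvdn_leq; rewrite absz_gt0 => /(_ Xn0).
  by rewrite leqNgt -ltz_nat abszE ltX.
(* Raising the exponents above the gap by [2 * l] multiplies the upper block by
   [q ^+ (2 * l) = 25 ^ (e * l)]. *)
exists (fun k => if low k then n k else n k + 2 * l)%N.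
rewrite /exp_sum_eqn (bigID low) /= addrA.
have -> : c0 + \sum_(k < d | low k) c k * q ^+ (if low k then n k else n k + 2 * l)%N = SL.
  by congr (_ + _); apply: eq_bigr => k ->.
have -> : \sum_(k < d | ~~ low k) c k * q ^+ (if low k then n k else n k + 2 * l)%N
    = q ^+ (2 * l) * SH.
  rewrite mulr_sumr; apply: eq_bigr => k /negPf ->; rewrite exprD; ring.
have -> : SL = (q - 1) * (5 ^ (2 * j))%N%:Z by move: X0; rewrite /X; lia.
have -> : SH = (q - 1) * (5 ^ (4 * j))%N%:Z by move: X0; rewrite XE; lia.
have -> : q ^+ (2 * l) = (25 ^ (e * l))%N%:Z.
  have -> : (25 ^ (e * l) = (5 ^ e) ^ (2 * l))%N by rewrite -(expnM 5 2) -expnM mulnCA.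
  by rewrite -[RHS]natz natrX natz.
rewrite -p4 -p2 expnD PoszM; ring.
Qed.

End ExpSum.

(** No [25 ^ i + 25 ^ j] lies strictly between [2 * 25 ^ s] and [25 ^ s.+1], and for [s = |m| + N]
    this gap is long enough to contain a term of the progression. *)
Lemma arith_prog_not_sparse (m l : int) (A : set nat) N :
  m != 0 -> (forall n, A n -> exists i j, n = 25 ^ i + 25 ^ j)%N ->
  exists2 n, (N <= n)%N & ~ A n /\ exists k, n%:Z = m * k + l.
Proof.
move=> m0 Asparse; pose M := `|m|%N; pose s := (M + N)%N.
have s_lt : (s < 25 ^ s)%N by exact: ltn_expl.
pose a : int := (2 * 25 ^ s)%N%:Z + 1.
pose n : int := a + ((l - a) %% m)%Z.
have r0 : 0 <= ((l - a) %% m)%Z by exact: modz_ge0.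
have r1 : ((l - a) %% m)%Z < M%:Z by rewrite /M abszE ltz_mod.
have n0 : 0 <= n by rewrite /n /a; lia.
exists `|n|%N; first by rewrite /n /a; lia.
split; last first.
  exists (- ((l - a) %/ m)%Z); rewrite gez0_abs // /n.
  have := divz_eq (l - a) m; lia.
move=> /Asparse [i [j nE]].
have n_gt : (2 * 25 ^ s < `|n|)%N by rewrite /n /a; lia.
have n_lt : (`|n| < 25 ^ s.+1)%N by rewrite expnS /n /a; lia.
have le25 k : (k <= s)%N || (25 ^ s.+1 <= 25 ^ k)%N.
  by rewrite leq_exp2l // leqNgt orNb.
have := le25 i; have := le25 j.
have i1 : (i <= s -> 25 ^ i <= 25 ^ s)%N by move=> H; rewrite leq_exp2l.
have j1 : (j <= s -> 25 ^ j <= 25 ^ s)%N by move=> H; rewrite leq_exp2l.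
case/orP => Hj; case/orP => Hi; try (move: (j1 Hj)); try (move: (i1 Hi)); lia.
Qed.

Lemma not_p_normal_nat5 (A : set nat) :
  (forall n, A n -> exists i j, n = 25 ^ i + 25 ^ j)%N ->
  (forall j, (0 < j)%N -> A (25 ^ (2 * j) + 25 ^ j)%N) ->
  (forall j, (0 < j)%N -> exists M, forall i, (M <= i)%N -> ~ A (25 ^ i + 25 ^ j)%N) ->
  ~ p_normal_nat 5 A.
Proof.
move=> Asparse Adiag Ahor [B [r [Bi [Bi_shape B_E]]] finAB].
have [N AB] : exists N, forall n, (N <= n)%N -> (A n <-> B n%:Z).
  have [s sE] : exists s : seq nat, A `+` [set n : nat | B n%:Z] = [set` s] by exact/finite_seqP.
  exists (\max_(n <- s) n.+1)%N => n ns.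
  have n_s : ~ (A `+` [set n : nat | B n%:Z]) n.
    rewrite sE /= => n_s; move: ns; apply/negP; rewrite -ltnNge.
    exact: (@leq_bigmax_seq _ _ predT (fun n => n.+1)).
  split=> [An|Bn]; apply: contrapT => H; apply: n_s; [by left | by right].
(* Each piece contains only finitely many diagonal elements: a progression is a single point or
   conflicts with sparsity, and an exponential-sum set would by [exp_sum_shift] contain infinitely
   many [25 ^ i + 25 ^ j] with [j] fixed. *)
have bad i : exists J, forall j, (J <= j)%N -> (0 < j)%N ->
    ~ Bi i ((25 ^ (2 * j))%N%:Z + (25 ^ j)%N%:Z).
  have [[m [l BE]]|[e [d [c0 [c [e0 _ _ BE]]]]]] := Bi_shape i.
    have [m0|m0] := eqVneq m 0.
      exists `|l|.+1 => j jl _; rewrite BE => -[k _]; rewrite m0 mul0r add0r => lE.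
      have := ltn_expl j (isT : 1 < 25)%N; lia.
    have [n Nn [nA [k nE]]] := @arith_prog_not_sparse m l A N m0 Asparse.
    case: nA; apply/AB => //; rewrite B_E; exists i; rewrite BE; by exists k.
  have [J HJ] := @exp_sum_shift e d c0 c e0.
  exists J => j Jj j0; rewrite BE /= => -[n /(exp_sum_eqnP c0 c e0) En].
  have {}HJ := HJ j n Jj En.
  (* The shift by [M + N] passes both the threshold of [Ahor] and the finite set where [A] and [B]
     differ. *)
  have [M HM] := Ahor j j0; apply: (HM (2 * j + e * (M + N))%N); first by nia.
  have lt25 k := ltn_expl k (isT : 1 < 25)%N.
  apply/AB; first by have := lt25 (2 * j + e * (M + N))%N; nia.
  rewrite B_E; exists i; rewrite BE /= PoszD.
  have [n' En'] := HJ (M + N)%N; exists n'.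
  exact/(exp_sum_eqnP c0 c e0).
have [J HJ] := choice bad.
(* This [j] is beyond the thresholds of all pieces, so none of them contains the diagonal
   element. *)
pose j := (N + \max_i J i).+1.
have jJ i : (J i <= j)%N by rewrite /j; have := @leq_bigmax _ J i; lia.
have j0 : (0 < j)%N by [].
have lt25 k := ltn_expl k (isT : 1 < 25)%N.
have : B (25 ^ (2 * j) + 25 ^ j)%N%:Z.
  by apply/AB; [have := lt25 j; rewrite /j; lia | exact: Adiag].
by rewrite B_E => -[i]; rewrite PoszD; exact: HJ.
Qed.

Theorem proposition5p5
    (K : closedFieldType) (iota : {rmorphism {fraction {poly 'F_5}} -> K})
    (K_alg : forall x : K, algebraicOver iota x)
    (t : K) (t_def : t = iota (@FracField.tofrac {poly 'F_5} 'X))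
    (F25 : finFieldType) (F25_card : #|F25| = (5 ^ 2)%N)
    (j : {rmorphism F25 -> K})
    (a : {unit F25}) (a_gen : generator [set: {unit F25}]%SET a)
    (alpha : K) (alpha_def : alpha = j (val a))
    (s1 s2 : K) (s1_def : s1 ^+ 2 = (t + 1) ^+ 3 + 1)
    (s2_def : s2 ^+ 2 = t ^+ 3 + 1)
    (x y z u v : Gm K) (P Q : ecurve K)
    (x_def : gm_val x = t + alpha) (y_def : gm_val y = t - alpha)
    (z_def : gm_val z = t) (u_def : gm_val u = t + 1) (v_def : gm_val v = t)
    (P_def : ec_val P = Some (t + 1, s1)) (Q_def : ec_val Q = Some (t, s2))
    (g : Gm3 K * Gm2E2 K) (g_def : g = ((x, y, z), (u, v, P, Q))) :
  exists V : set (Gm2E2 K), closed_subvariety V /\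
    ~ p_normal_nat 5 [set n : nat | (V0 alpha `*` V) (g *+ n)].
Proof.
pose ev : {rmorphism {poly 'F_5} -> K} :=
  GRing.RMorphism.clone _ _ (iota \o @FracField.tofrac {poly 'F_5}) _.
have ev_inj : injective ev.
  by move=> p q /fmorph_inj /eqP; rewrite tofrac_eq => /eqP.
have tE : t = ev 'X by [].
have t_inj : injective (fun k : nat => t ^+ k).
  have -> : t = ev ('X + 0%:P) by rewrite addr0.
  exact: ev_XaddC_exp_inj.
rewrite tE in P_def Q_def u_def v_def.
exists [set w | qelim_norm w = 0]; split; first exact: closed_qelim_norm.
set A := [set n : nat | _].
have AE n : A n <-> (exists i k, n = (25 ^ i + 25 ^ k)%N) /\
    qelim_norm (u *+ n, v *+ n, P *+ n, Q *+ n) = 0.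
  rewrite /A g_def /= !pair_mulrn /V0 /= !gm_valMn x_def y_def z_def alpha_def.
  have V0E := V0_exponent F25_card j a_gen t_inj n.
  by split=> -[/V0E H1 H2]; split.
apply: not_p_normal_nat5 => [n /AE [] // | i i0 | i i0].
  apply/AE; split; first by exists (2 * i)%N, i.
  exact: (qelim_norm_diag ev_inj P_def Q_def u_def v_def i0).
have [N HN] := qelim_norm_neq0 ev_inj P_def Q_def u_def v_def i0.
by exists N => k /HN H /AE [_ /H].
Qed.
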